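(* Let $P\subseteq\mathbb{R}$, with the usual total order, and let $\mu$ be a measure on $P$ such that for each interval $I$ in $P$, $\mu(I)=\inf P_{>I}-\inf I$. Let $K$ be a field and let $M,N:P\to\mathbf{Vect}_K$ be persistence modules that have a persistence diagram. Then for $1\le p\le\infty$, $$W_p(d_{\mu\circ\dim})(M,N)=\inf\big\|\{\mu(M_a\bigtriangleup N_a)\}_{a\in A}\big\|_p=W_p(M,N),$$ where the infimum is taken over all isomorphisms $M\cong\bigoplus_{a\in A}M_a$ and $N\cong\bigoplus_{a\in A}N_a$ in which every $M_a$ and $N_a$ is either an interval module or zero (the zero module corresponding to the empty set).
   Context: An interval in $P$ is a nonempty convex subset. For an interval $I$, $P_{>I}=\{p\in P: x<p\text{ for all }x\in I\}$, with $\inf\emptyset=\infty$. View $P$ as a category via $\le$; a persistence module is a functor $P\to\mathbf{Vect}_K$. The interval module of an interval $I$ (also denoted $I$) has value $K$ at points of $I$, $0$ elsewhere, and identity maps between points of $I$. $\bigtriangleup$ is the symmetric difference of the corresponding subsets of $P$. For families in $[0,\infty]$, $\|x\|_p=(\sum_a x_a^p)^{1/p}$ for $p<\infty$ and $\|x\|_\infty=\sup_a x_a$. Path metric: $d_{\mu\circ\dim}(M,N)$ is the infimum over all finite zigzags of morphisms $f_1,\dots,f_n$ of persistence modules (in either direction) joining $M$ to $N$, such that the functions $p\mapsto\dim\ker f_i(p)$ and $p\mapsto\dim\operatorname{coker}f_i(p)$ are $\mu$-integrable (measurable with finite integral), of $\sum_i\big(\int_P\dim\ker f_i\,d\mu+\int_P\dim\operatorname{coker}f_i\,d\mu\big)$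 (value $\infty$ if there is no such zigzag). Algebraic $p$-Wasserstein distance: for a metric $d$ and $M,N$ isomorphic to direct sums of objects with local endomorphism rings, $W_p(d)(M,N)=\inf\|\{d(M_a,N_a)\}_{a\in A}\|_p$ over all isomorphisms $M\cong\bigoplus_{a\in A}M_a$, $N\cong\bigoplus_{a\in A}N_a$ with each $M_a,N_a$ either $0$ or with a local endomorphism ring. (Interval modules have local endomorphism ring $K$.) Persistence diagrams: for an interval $I$ let $x(I)=(\inf I,\inf P_{>I})\in[-\infty,\infty]^2$. $M$ has a persistence diagram if $M\cong\bigoplus_{j\in J}I_j$ with each $I_j$ an interval module; then $\operatorname{Dgm}M$ is the multiset $\{x(I_j)\}_{j\in J}$. For $x,y\in[-\infty,\infty]^2$ let $d(x,y)=\|x-y\|_1$ (where the absolute difference of two equal infinite coordinates is $0$), and let $d(x,\Delta)=d(\Delta,x)=\inf_{y\in\Delta}d(x,y)$, where $\Delta$ is the diagonal of $[-\infty,\infty]^2$. If $\operatorname{Dgm}M=\{x_a\}_{a\in A}$ and $\operatorname{Dgm}N=\{x'_b\}_{b\in B}$, then $W_p(M,N)$ is the infimum, over all matchings (subsets $C\subseteq A$ with injections $\varphi:C\to B$), of the $p$-norm of the combined family consisting of $\{d(x_c,x'_{\varphi(c)})\}_{c\in C}$, $\{d(x_a,\Delta)\}_{a\in A\setminus C}$ and $\{d(\Delta,x'_b)\}_{b\in B\setminus\varphi(C)}$. *)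

(* Defs.v *)
From HB Require Import structures.
From mathcomp Require Import all_boot all_order all_algebra.
From mathcomp Require Import all_classical all_reals all_analysis.

Set Implicit Arguments.
Unset Strict Implicit.
Unset Printing Implicit Defensive.

Import Order.TTheory GRing.Theory Num.Theory.
(* Without this import, g_sigma_algebraType S with S : set_system R silently gets
   the Borel structure of R as its measurableType structure.                   *)
Import numFieldNormedType.Exports.

Local Open Scope classical_set_scope.
Local Open Scope ring_scope.

Section DirectSum.
Variables (K : fieldType) (A : Type) (V : A -> lmodType K).

Definition dprod : Type := forall a, V a.

HB.instance Definition _ := Choice.copy dprod (forall a, V a).

Implicit Types f g h : dprod.

Definition dprod_zero : dprod := fun=> 0.
Definition dprod_opp f : dprod := fun a => - f a.
Definition dprod_add f g : dprod := fun a => f a + g a.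
Definition dprod_scale (k : K) f : dprod := fun a => k *: f a.

Fact dprod_addA : associative dprod_add.
Proof. by move=> f g h; apply: functional_extensionality_dep => a; exact: addrA. Qed.
Fact dprod_addC : commutative dprod_add.
Proof. by move=> f g; apply: functional_extensionality_dep => a; exact: addrC. Qed.
Fact dprod_add0 : left_id dprod_zero dprod_add.
Proof. by move=> f; apply: functional_extensionality_dep => a; exact: add0r. Qed.
Fact dprod_addN : left_inverse dprod_zero dprod_opp dprod_add.
Proof. by move=> f; apply: functional_extensionality_dep => a; exact: addNr. Qed.

HB.instance Definition _ :=
  GRing.isZmodule.Build dprod dprod_addA dprod_addC dprod_add0 dprod_addN.

Fact dprod_scaleA k l f :
  dprod_scale k (dprod_scale l f) = dprod_scale (k * l) f.
Proof. by apply: functional_extensionality_dep => a; exact: scalerA. Qed.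
Fact dprod_scale1 : left_id 1 dprod_scale.
Proof. by move=> f; apply: functional_extensionality_dep => a; exact: scale1r. Qed.
Fact dprod_scaleDr : right_distributive dprod_scale +%R.
Proof. by move=> k f g; apply: functional_extensionality_dep => a; exact: scalerDr. Qed.
Fact dprod_scaleDl f : {morph dprod_scale^~ f : k l / k + l}.
Proof. by move=> k l; apply: functional_extensionality_dep => a; exact: scalerDl. Qed.

HB.instance Definition _ :=
  GRing.Zmodule_isLmodule.Build K dprod
    dprod_scaleA dprod_scale1 dprod_scaleDr dprod_scaleDl.

Definition fin_supp : {pred dprod} :=
  fun f => `[< finite_set [set a | f a != 0] >].

Fact fin_supp_submod : submod_closed fin_supp.
Proof.
split=> [|k f g /asboolP fF /asboolP gF]; apply/asboolP.
  rewrite (_ : [set a | _] = set0); first exact: finite_set0.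
  by apply/seteqP; split=> // a /=; rewrite eqxx.
apply: (@sub_finite_set _ _ ([set a | f a != 0] `|` [set a | g a != 0])).
  move=> a /= fga; apply: contrapT => /not_orP[/negP/negPn/eqP fa0].
  move=> /negP/negPn/eqP ga0; move/eqP: fga; apply.
  rewrite -[LHS]/(k *: f a + g a) fa0 ga0 scaler0 addr0; exact: erefl.
by rewrite finite_setU.
Qed.

HB.instance Definition _ :=
  GRing.isSubmodClosed.Build K dprod fin_supp fin_supp_submod.

Definition dsum : Type := {f : dprod | f \in fin_supp}.

HB.instance Definition _ := SubType.copy dsum {f : dprod | f \in fin_supp}.
HB.instance Definition _ := [Choice of dsum by <:].
HB.instance Definition _ := [SubChoice_isSubLmodule of dsum by <:].

End DirectSum.

Section DirectSumMap.
Variables (K : fieldType) (A : Type) (V W : A -> lmodType K).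
Variable phi : forall a, {linear V a -> W a}.

Fact dsum_map_supp (f : dsum V) :
  ((fun a => phi a (val f a)) : dprod W) \in @fin_supp K A W.
Proof.
apply/asboolP; have /asboolP fF := valP f; apply: sub_finite_set fF => a /=.
by apply: contra_neq => ->; rewrite linear0.
Qed.

Definition dsum_map (f : dsum V) : dsum W :=
  exist _ ((fun a => phi a (val f a)) : dprod W) (dsum_map_supp f).

Fact dsum_map_linear : linear dsum_map.
Proof.
move=> k f g; apply: val_inj; apply: functional_extensionality_dep => a.
exact: (linearP (phi a) k (val f a) (val g a)).
Qed.

HB.instance Definition _ :=
  GRing.isLinear.Build K (dsum V) (dsum W) _ dsum_map dsum_map_linear.

End DirectSumMap.

(* The dimension of the quotient U / W of nested subspaces W <= U of V, +oo
   when it is infinite: e is a family of vectors of U whose classes form a basis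
   of U / W, and inf set0 = +oo.                                               *)
Definition dim_quo (R : realType) (K : fieldType) (V : lmodType K)
    (U W : set V) : \bar R :=
  ereal_inf [set n%:R%:E | n in [set n | exists e : 'I_n -> V,
    (forall i, U (e i)) /\
    (forall v, U v -> exists! c : 'rV[K]_n, W (v - \sum_i c 0 i *: e i))]].

Section Modules.
Variables (R : realType) (P : set R) (K : fieldType).

Record pmod := Pmod {
  pval :> P -> lmodType K;
  pmap : forall s t : P, val s <= val t -> {linear pval s -> pval t};
  pmap_id : forall s (ss : val s <= val s) v, pmap ss v = v;
  pmap_comp : forall s t u (st : val s <= val t) (tu : val t <= val u)
    (su : val s <= val u) v, pmap tu (pmap st v) = pmap su v }.

Record hom (M N : pmod) := Hom {
  hom_fun :> forall t, {linear M t -> N t};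
  hom_natural : forall s t (st : val s <= val t) v,
    hom_fun t (pmap M st v) = pmap N st (hom_fun s v) }.

Definition is_iso (M N : pmod) (f : hom M N) :=
  exists g : hom N M,
    (forall t v, g t (f t v) = v) /\ (forall t v, f t (g t v) = v).

Definition isomorphic (M N : pmod) := exists f : hom M N, is_iso f.

Definition is_zero (M : pmod) := forall t (v : M t), v = 0.

Section HomAdd.
Variables (M N : pmod) (f g : hom M N).

Definition hom_add_fun t : {linear M t -> N t} := (f t \+ g t).

Fact hom_add_natural s t (st : val s <= val t) v :
  hom_add_fun t (pmap M st v) = pmap N st (hom_add_fun s v).
Proof. by rewrite /= !hom_natural linearD. Qed.

Definition hom_add : hom M N := Hom hom_add_natural.

End HomAdd.

(* End(M) is local: 1 != 0 and the non-units form an additive subset.  In End(M)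
   the units are the isomorphisms, and 1 = 0 exactly when M is zero.           *)
Definition local_end (M : pmod) :=
  ~ is_zero M /\
  forall f g : hom M M, ~ is_iso f -> ~ is_iso g -> ~ is_iso (hom_add f g).

Section PmodSum.
Variables (A : Type) (M : A -> pmod).

Let dval (t : P) : lmodType K := dsum (fun a => M a t).
Let dmap s t (st : val s <= val t) : {linear dval s -> dval t} :=
  dsum_map (fun a => pmap (M a) st).

Fact pmod_sum_id s (ss : val s <= val s) v : dmap ss v = v.
Proof.
apply: val_inj; apply: functional_extensionality_dep => a.
exact: pmap_id.
Qed.

Fact pmod_sum_comp s t u (st : val s <= val t) (tu : val t <= val u)
  (su : val s <= val u) v : dmap tu (dmap st v) = dmap su v.
Proof.
apply: val_inj; apply: functional_extensionality_dep => a.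
exact: pmap_comp.
Qed.

Definition pmod_sum : pmod := Pmod pmod_sum_id pmod_sum_comp.

End PmodSum.

(* Possibly empty; the intervals of P are the nonempty ones.                   *)
Structure convex_subset := ConvexSubset {
  cset :> set R;
  cset_sub : cset `<=` P;
  cset_convex : forall x y z, cset x -> cset z -> P y ->
    x <= y -> y <= z -> cset y }.

(* K at the points of I and 0 elsewhere, encoded as row vectors of length 1 or 0;
   const_mx 1 is the identity of 'rV[K]_1 between points of I.  For empty I this
   is the zero module.                                                         *)
Section IntervalModule.
Variable I : convex_subset.

Let ival (t : P) : lmodType K := 'rV[K]_(val t \in cset I).
Let imap s t (st : val s <= val t) : {linear ival s -> ival t} :=
  mulmxr (const_mx 1).

Fact interval_mod_id s (ss : val s <= val s) v : imap ss v = v.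
Proof.
rewrite /imap /=; rewrite /ival in v *.
case: (val s \in cset I) v => v; last by apply/rowP => -[].
apply/rowP => i; rewrite !ord1 mxE big_ord1 mxE mulr1; congr (v _ _).
Qed.

Fact interval_mod_comp s t u (st : val s <= val t) (tu : val t <= val u)
  (su : val s <= val u) v : imap tu (imap st v) = imap su v.
Proof.
rewrite /imap /= -mulmxA; congr (_ *m _).
apply/matrixP => i j; rewrite !mxE.
have sI : val s \in cset I by case: (val s \in cset I) i => // -[].
have uI : val u \in cset I by case: (val u \in cset I) j => // -[].
have tI : val t \in cset I.
  rewrite !inE in sI uI *.
  exact: (cset_convex sI uI (set_mem (valP t)) st tu).
under eq_bigr do rewrite !mxE mulr1.
by rewrite sumr_const card_ord tI.
Qed.

Definition interval_mod : pmod := Pmod interval_mod_id interval_mod_comp.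

End IntervalModule.

End Modules.

Section Interval.
Variables (R : realType) (P : set R).
Local Open Scope ereal_scope.

Definition above (I : set R) : set R :=
  [set y | P y /\ forall x, I x -> (x < y)%R].

Definition dgm_point (I : set R) : \bar R * \bar R :=
  (ereal_inf (EFin @` I), ereal_inf (EFin @` above I)).

(* Multisets are represented by indexed families.                              *)
Definition is_dgm (K : fieldType) (M : pmod P K) (A : Type)
    (x : A -> \bar R * \bar R) :=
  exists I : A -> convex_subset P,
    (forall a, cset (I a) !=set0) /\
    isomorphic M (pmod_sum (fun a => interval_mod K (I a))) /\
    (forall a, x a = dgm_point (I a)).

End Interval.

Section Wasserstein.
Variable R : realType.
Local Open Scope ereal_scope.

(* For p = +oo, adding 0 makes the supremum of the empty family 0; the value at
   p = -oo is meaningless.                                                     *)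
Definition pnorm (p : \bar R) (A : choiceType) (x : A -> \bar R) : \bar R :=
  match p with
  | r%:E => poweR (\esum_(a in [set: A]) poweR (x a) r) r^-1
  | +oo => ereal_sup (0 |` range x)
  | -oo => 0
  end.

Definition algebraic_Wp (P : set R) (K : fieldType)
    (d : pmod P K -> pmod P K -> \bar R) (p : \bar R) (M N : pmod P K) : \bar R :=
  ereal_inf [set r | exists (A : choiceType) (M_ N_ : A -> pmod P K),
    (forall a, is_zero (M_ a) \/ local_end (M_ a)) /\
    (forall a, is_zero (N_ a) \/ local_end (N_ a)) /\
    isomorphic M (pmod_sum M_) /\ isomorphic N (pmod_sum N_) /\
    r = pnorm p (fun a => d (M_ a) (N_ a))].

Definition absdiff (x y : \bar R) : \bar R := if x == y then 0 else `|x - y|.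

Definition dist1 (x y : \bar R * \bar R) : \bar R :=
  absdiff x.1 y.1 + absdiff x.2 y.2.

Definition dist_diag (x : \bar R * \bar R) : \bar R :=
  ereal_inf [set dist1 x y | y in [set y | y.1 = y.2]].

Definition diagram_Wp (p : \bar R) (A B : choiceType)
    (x : A -> \bar R * \bar R) (y : B -> \bar R * \bar R) : \bar R :=
  ereal_inf [set r | exists (C : set A) (phi : C -> B), injective phi /\
    r = pnorm p (fun i : C + (~` C) + (~` range phi) =>
      match i with
      | inl (inl c) => dist1 (x (val c)) (y (phi c))
      | inl (inr a) => dist_diag (x (val a))
      | inr b => dist_diag (y (val b))
      end)].

End Wasserstein.

(* A measurableType is nonempty in the library, but P may be empty.  So a measure
   on P is given by a sigma-algebra S on P, made of subsets of P, and a measure on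
   the sigma-algebra of R generated by S, whose trace on P is S; only its values
   on S and integrals over P are used.                                         *)
Section PathMetric.
Variables (R : realType) (P : set R) (S : set_system R).
Variable mu : {measure set (g_sigma_algebraType S) -> \bar R}.
Variable K : fieldType.
Local Open Scope ereal_scope.

Section Cost.
Variables (M N : pmod P K) (f : hom M N).

Definition dim_ker : g_sigma_algebraType S -> \bar R :=
  'valL_ 0 (fun t : P => dim_quo R [set v | f t v = 0%R] [set 0%R]).

Definition dim_coker : g_sigma_algebraType S -> \bar R :=
  'valL_ 0 (fun t : P => dim_quo R setT (range (f t))).

Definition admissible := mu.-integrable P dim_ker /\ mu.-integrable P dim_coker.

Definition cost : \bar R :=
  \int[mu]_(t in P) dim_ker t + \int[mu]_(t in P) dim_coker t.

End Cost.

Inductive zigzag : pmod P K -> pmod P K -> \bar R -> Prop :=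
| zigzag_nil M : zigzag M M 0
| zigzag_forth M M' N (f : hom M M') c :
    admissible f -> zigzag M' N c -> zigzag M N (cost f + c)
| zigzag_back M M' N (f : hom M' M) c :
    admissible f -> zigzag M' N c -> zigzag M N (cost f + c).

Definition path_dist (M N : pmod P K) : \bar R := ereal_inf (zigzag M N).

(* A convex subset is an interval or empty, and accordingly its module is an
   interval module or zero.                                                    *)
Definition interval_Wp (p : \bar R) (M N : pmod P K) : \bar R :=
  ereal_inf [set r | exists (A : choiceType) (I J : A -> convex_subset P),
    isomorphic M (pmod_sum (fun a => interval_mod K (I a))) /\
    isomorphic N (pmod_sum (fun a => interval_mod K (J a))) /\
    r = pnorm p (fun a => mu (cset (I a) `+` cset (J a)))].

End PathMetric.

(* Main.v *)
Require Import Defs.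
From HB Require Import structures.
From mathcomp Require Import all_boot all_order all_algebra finmap.
From mathcomp Require Import all_classical all_reals all_analysis measurable_realfun.
Import Defs.

(* Path distance of interval modules. At a point t where the kernels and
   cokernels of all the maps of a zigzag vanish, the two ends vanish
   simultaneously; hence a zigzag from I to J costs at least mu (I `+` J).
   Conversely the points of I and J that lie above a point of I and above a point
   of J form an interval L with canonical maps L -> I and L -> J, and the zigzag
   I <- L -> J costs exactly mu (I `+` J). Direct summands with local endomorphism
   rings of a sum of interval modules are themselves interval modules, so the
   algebraic distance only involves interval decompositions.

   Uniqueness of interval decompositions. At a point t of an interval L, the
   generators of the summands equal to L are a basis of the span of the vectors
   coming from L, modulo the vectors killed by every map to L. An exchange
   argument by Zorn's lemma and the Cantor-Bernstein theorem then identify the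
   index sets of any two decompositions, even infinite ones.

   Diagrams. If I meets J then mu (I `+` J) is the l1 distance of their points;
   otherwise it is the sum of their distances to the diagonal, which is at most
   the l1 distance. Since x^p + y^p <= (x + y)^p for p >= 1, sending both members of
   a disjoint pair to the diagonal does not increase the p-norm. *)

Set Implicit Arguments.
Unset Strict Implicit.
Unset Printing Implicit Defensive.

Import Order.TTheory GRing.Theory Num.Theory.
Import numFieldNormedType.Exports.

Local Open Scope classical_set_scope.
Local Open Scope ring_scope.

(** * The exchange lemma *)

Section Span.
Variables (K : fieldType) (V : lmodType K).
Implicit Types (S Q : set V) (u v : V).

Definition is_submodule Q := Q 0 /\ forall k u v, Q u -> Q v -> Q (k *: u + v).

(** The intersection of all submodules that contain [S]. In this impredicative form a membership is
    used by choosing a suitable submodule, and no linear combination is ever written. *)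
Definition span S : set V :=
  [set v | forall Q, is_submodule Q -> S `<=` Q -> Q v].

Lemma span_submodule S : is_submodule (span S).
Proof.
split=> [Q [Q0 _] _ //|k u v Su Sv Q subQ SQ].
exact: subQ.2 (Su _ subQ SQ) (Sv _ subQ SQ).
Qed.

Lemma sub_span S : S `<=` span S.
Proof. by move=> v Sv Q _; apply. Qed.

Lemma span_min S Q : is_submodule Q -> S `<=` Q -> span S `<=` Q.
Proof. by move=> subQ SQ v; apply. Qed.

Lemma span_mono S S' : S `<=` S' -> span S `<=` span S'.
Proof.
by move=> SS'; apply: span_min (span_submodule _) _ => v /SS'; exact: sub_span.
Qed.

Lemma submoduleZ Q k u : is_submodule Q -> Q u -> Q (k *: u).
Proof. by move=> [Q0 QL] Qu; rewrite -[_ *: _]addr0; exact: QL. Qed.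

Lemma submoduleD Q u v : is_submodule Q -> Q u -> Q v -> Q (u + v).
Proof. by move=> [_ QL] Qu Qv; rewrite -[u]scale1r; exact: QL. Qed.

Lemma span_setU1 S u v : span (S `|` [set u]) v -> exists k, span S (v - k *: u).
Proof.
have [S0 SL] := span_submodule S.
apply: (span_min (Q := [set v | exists k, span S (v - k *: u)])).
  split=> [|k a b [ka Ha] [kb Hb]] /=; first by exists 0; rewrite scale0r subr0.
  exists (k * ka + kb); have := SL k _ _ Ha Hb; congr span.
  by rewrite scalerBr scalerDl scalerA opprD addrACA.
move=> w [Sw|->] /=; first by exists 0; rewrite scale0r subr0; exact: sub_span.
by exists 1; rewrite scale1r subrr.
Qed.

End Span.

Section Exchange.
Variables (K : fieldType) (V : lmodType K) (W : set V).

(** Over a field this is linear independence of the classes modulo the span of [W], expressed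
    without forming the quotient. *)
Definition free_mod (X : Type) (e : X -> V) :=
  forall x, ~ span (W `|` e @` [set~ x]) (e x).

Lemma free_mod_inj X (e : X -> V) : free_mod e -> injective e.
Proof.
move=> fe x1 x2 ex; apply: contrapT => x12; apply: (fe x1).
by rewrite ex; apply: sub_span; right; exists x2 => // x21; exact: x12.
Qed.

Variables (X Y : Type) (e : X -> V) (e' : Y -> V).
Hypothesis free_e : free_mod e.
Hypothesis span_e' : forall x, span (W `|` range e') (e x).

Let subst (f : X -> option Y) x := if f x is Some y then e' y else e x.

Let le_part (f g : X -> option Y) := forall x y, f x = Some y -> g x = Some y.

Let free_part f := free_mod (subst f).

(** The bound is the union of the chain. It stays independent because a dependence in the union
    already occurs at some stage. *)
Let chain_bound (A : set {f | free_part f}) :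
  total_on A (fun f g => le_part (sval f) (sval g)) ->
  exists t : {f | free_part f}, forall s, A s -> le_part (sval s) (sval t).
Proof.
move=> totA; have [[f0 Af0]|A0] := pselect (exists f, A f); last first.
  have f0 : free_mod (subst (fun=> None)) by exact: free_e.
  by exists (exist free_part _ f0) => s As; case: A0; exists s.
have /choice[F F_spec] x : exists o : option Y,
    (forall f y, A f -> sval f x = Some y -> o = Some y) /\
    (forall y, o = Some y -> exists2 f, A f & sval f x = Some y).
  have [[f Af fx]|H] := pselect (exists2 f, A f & sval f x <> None); last first.
    by exists None; split=> // f y Af fx; case: H; exists f; rewrite ?fx.
  case fxy : (sval f x) fx => [y|//] _; exists (Some y); split=> [g z Ag gx|z [<-]].
    by have [/(_ _ _ fxy)|/(_ _ _ gx)] := totA _ _ Af Ag; rewrite ?gx ?fxy => -[->].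
  by exists f.
have AF f x y : A f -> sval f x = Some y -> F x = Some y.
  exact: (F_spec x).1.
(* Each single vector of the substituted family is constant from some stage of the chain on. *)
have Fstage x : exists2 f, A f & forall g, A g -> le_part (sval f) (sval g) ->
    subst (sval g) x = subst F x.
  rewrite /subst; case Fx : (F x) => [y|].
    by have [f Af fx] := (F_spec x).2 _ Fx; exists f => // g Ag /(_ _ _ fx) ->.
  by exists f0 => // g Ag _; case gx: (sval g x) => [y|//]; rewrite (AF _ _ _ Ag gx) in Fx.
have le_trans_part f g h : le_part f g -> le_part g h -> le_part f h.
  by move=> fg gh x y /fg/gh.
have Amax f g : A f -> A g -> exists h, [/\ A h, le_part (sval f) (sval h)
    & le_part (sval g) (sval h)].
  by move=> Af Ag; have [?|?] := totA _ _ Af Ag; [exists g|exists f]; split.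
suff fF : free_mod (subst F) by exists (exist free_part F fF) => s As x y; exact: AF.
move=> x1 spanx1.
(* The vectors that lie in the span at all late stages form a submodule, since the chain is
   directed. It contains [W] and the generators of the union, hence their whole span; this replaces
   an argument on finite supports. *)
have : [set v | exists2 f, A f & forall g, A g -> le_part (sval f) (sval g) ->
    span (W `|` subst (sval g) @` [set~ x1]) v] (subst F x1).
  apply: spanx1.
    split=> [|k u v [f Af Hf] [g Ag Hg]].
      by exists f0 => // g _ _; exact: (span_submodule _).1.
    have [h [Ah fh gh]] := Amax _ _ Af Ag; exists h => // l Al hl.
    by apply: (span_submodule _).2; [apply: Hf|apply: Hg] => //; exact: le_trans_part hl.
  move=> v [Wv|[x xx1 <-]].
    by exists f0 => // g _ _; apply: sub_span; left.
  have [f Af Hf] := Fstage x; exists f => // g Ag fg.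
  by apply: sub_span; right; exists x => //; exact: Hf.
move=> [f Af Hf]; have [g Ag Hg] := Fstage x1.
have [h [Ah fh gh]] := Amax _ _ Af Ag.
by apply: (svalP h x1); rewrite Hg//; exact: Hf.
Qed.

Let extend (f : X -> option Y) x0 y x := if `[< x = x0 >] then Some y else f x.

(** In a dependence of another vector [subst f x1] on the new family, let [k] be the coefficient of
    [e' y]. If [k = 0], the old family was dependent; otherwise the relation is solved for [e' y],
    which then lies in the excluded span. *)
Let extend_free f x0 y : free_mod (subst f) ->
  ~ span (W `|` subst f @` [set~ x0]) (e' y) -> free_mod (subst (extend f x0 y)).
Proof.
move=> ff ny; set g := extend f x0 y.
have gx0 : subst g x0 = e' y by rewrite /subst /g /extend; case: asboolP.
have gx x : x <> x0 -> subst g x = subst f x.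
  by rewrite /subst /g /extend; case: asboolP.
move=> x1; have [->|x10] := pselect (x1 = x0).
  rewrite gx0 => H; apply: ny; apply: span_mono H => v [Wv|[x xx0 <-]]; first by left.
  by right; exists x => //; rewrite gx.
rewrite gx// => H.
pose T := W `|` subst f @` [set x | x <> x0 /\ x <> x1].
have : span (T `|` [set e' y]) (subst f x1).
  apply: span_mono H => v [Wv|[x xx1 <-]]; first by left; left.
  have [->|xx0] := pselect (x = x0); first by right.
  by left; right; exists x; rewrite ?gx.
move=> /span_setU1[k]; have [->|k0] := eqVneq k 0.
  rewrite scale0r subr0 => {}H; apply: (ff x1); apply: span_mono H => v [Wv|[x [? ?] <-]].
    by left.
  by right; exists x.
move=> {}H; apply: ny.
have TS : span T `<=` span (W `|` subst f @` [set~ x0]).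
  apply: span_mono => v [Wv|[x [? ?] <-]]; first by left.
  by right; exists x.
have -> : e' y = (- k^-1) *: (subst f x1 - k *: e' y) + k^-1 *: subst f x1.
  by rewrite scalerBr !scaleNr scalerA mulVf// scale1r opprK addrC addrA subrr add0r.
apply: (span_submodule _).2; first exact: TS.
by apply: submoduleZ (span_submodule _) _; apply: sub_span; right; exists x1.
Qed.

(* Steinitz exchange for infinite families: a maximal partial substitution of
   the e' y for the e x that preserves independence is total. *)
Lemma free_mod_le_span : exists h : X -> Y, injective h.
Proof.
have f0 : free_mod (subst (fun=> None)) by exact: free_e.
have [] := @ZL_preorder {f | free_part f} (exist free_part _ f0)
  (fun f g => `[< le_part (sval f) (sval g) >]).
- by move=> f; apply/asboolP.
- by move=> f g h /asboolP fg /asboolP gh; apply/asboolP => x y /fg/gh.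
- move=> A totA; have [|t At] := @chain_bound A.
    by move=> s t As At; have [/asboolP|/asboolP] := totA _ _ As At; [left|right].
  by exists t => s As; apply/asboolP; exact: At.
move=> [f ff] fmax.
have ftot x0 : exists y, f x0 = Some y.
  case fx0 : (f x0) => [y|]; first by exists y.
  have [[y ny]|H] := pselect (exists y, ~ span (W `|` subst f @` [set~ x0]) (e' y)).
    have le_fg : `[< le_part f (extend f x0 y) >].
      by apply/asboolP => x z /=; rewrite /extend; case: asboolP => // ->; rewrite fx0.
    have /asboolP le_gf := fmax (exist free_part _ (extend_free ff ny)) le_fg.
    by exists y; rewrite -fx0; apply: (le_gf x0); rewrite /= /extend; case: asboolP.
  (* If no [e' y] could replace [e x0], the remaining vectors would span every [e' y], hence [e x0]
     itself. *)
  exfalso; apply: (ff x0).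
  rewrite {2}/subst fx0; apply: (span_min _ _ (span_e' x0)) => [|v [Wv|[y _ <-]]].
  - exact: span_submodule.
  - by apply: sub_span; left.
  - by apply: contrapT => ny; apply: H; exists y.
have [h fh] := choice ftot; exists h => x1 x2 hx.
(* Injectivity is not built into a substitution; it follows from independence of the substituted
   family. *)
apply: (free_mod_inj ff); rewrite /subst !fh hx.
by [].
Qed.

End Exchange.

(** * Direct sums of persistence modules *)

Section DirectSumTheory.
Variables (K : fieldType) (A : choiceType) (V : A -> lmodType K).
Implicit Types (v : dsum V).

Definition dcoord a v : V a := val v a.

Lemma dcoord_linear a : linear (dcoord a).
Proof. by []. Qed.

HB.instance Definition _ a :=
  GRing.isLinear.Build K (dsum V) (V a) _ (dcoord a) (dcoord_linear a).

Lemma dsumP v w : (forall a, dcoord a v = dcoord a w) -> v = w.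
Proof. by move=> vw; apply: val_inj; apply: functional_extensionality_dep. Qed.

Lemma dcoord_supp v : finite_set [set a | dcoord a v != 0].
Proof. by have /asboolP := valP v. Qed.

Fact dinj_supp a (x : V a) :
  (eqtype.dfwith (fun b => 0 : V b) x : dprod V) \in @fin_supp K A V.
Proof.
apply/asboolP; apply: (@sub_finite_set _ _ [set a]); last exact: finite_set1.
move=> b /=; have [->//|ab] := eqVneq b a.
by rewrite dfwith_out 1?eq_sym ?eqxx.
Qed.

Definition dinj a (x : V a) : dsum V :=
  exist (fun f : dprod V => f \in @fin_supp K A V) _ (dinj_supp x).

Lemma dcoord_inj a (x : V a) : dcoord a (dinj x) = x.
Proof. exact: dfwith_in. Qed.

Lemma dcoord_inj_neq a b (x : V a) : a != b -> dcoord b (dinj x) = 0.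
Proof. exact: dfwith_out. Qed.

Lemma dinj_linear a : linear (@dinj a).
Proof.
move=> k x y; apply: dsumP => b; rewrite linearP /=.
have [<-|ab] := eqVneq a b; first by rewrite !dcoord_inj.
have z (w : V a) : dcoord b (dinj w) = 0 by exact: dcoord_inj_neq.
by rewrite !z scaler0 addr0.
Qed.

HB.instance Definition _ a :=
  GRing.isLinear.Build K (V a) (dsum V) _ (@dinj a) (@dinj_linear a).

Lemma dsum_expand v :
  v = \sum_(a <- fset_set [set a | dcoord a v != 0]) dinj (dcoord a v).
Proof.
apply: dsumP => b; rewrite linear_sum/=.
have [vb0|vb0] := eqVneq (dcoord b v) 0.
  rewrite big1 ?vb0// => a _; have [->|ab] := eqVneq a b.
    by rewrite vb0 linear0 linear0.
  exact: dcoord_inj_neq.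
rewrite (bigD1_seq b) ?fset_uniq//=; last first.
  by rewrite in_fset_set ?inE//; exact: dcoord_supp.
rewrite dcoord_inj big1 ?addr0// => a ab; exact: dcoord_inj_neq.
Qed.

Lemma span_dsum (S : set (dsum V)) v :
  (forall a, dcoord a v != 0 -> span S (dinj (dcoord a v))) -> span S v.
Proof.
move=> Sv; have subS := span_submodule S.
rewrite [v]dsum_expand; elim/big_ind: _ => [|x y|a _].
- exact: subS.1.
- exact: submoduleD.
- have [va0|/Sv//] := eqVneq (dcoord a v) 0.
  by rewrite va0 linear0; exact: subS.1.
Qed.

End DirectSumTheory.

(** * Morphisms and isomorphisms of persistence modules *)

Section Hom.
Variables (R : realType) (P : set R) (K : fieldType).
Implicit Types M N L : pmod P K.

Definition linear_of (U V : lmodType K) (f : U -> V) (flin : linear f) :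
    {linear U -> V} :=
  HB.pack f (GRing.isLinear.Build K U V _ f flin).

Lemma linear_ofE (U V : lmodType K) (f : U -> V) (flin : linear f) v :
  linear_of flin v = f v.
Proof. by []. Qed.

Definition hom_id M : hom M M :=
  @Hom R P K M M (fun t => idfun) (fun s t st v => erefl).

Fact hom_comp_natural M N L (g : hom N L) (f : hom M N) s t
    (st : val s <= val t) v :
  (g t \o f t) (pmap M st v) = pmap L st ((g s \o f s) v).
Proof. by rewrite /= !hom_natural. Qed.

Definition hom_comp M N L (g : hom N L) (f : hom M N) : hom M L :=
  @Hom R P K M L (fun t => g t \o f t) (hom_comp_natural g f).

Fact hom_opp_natural M N (f : hom M N) s t (st : val s <= val t) v :
  (\- f t) (pmap M st v) = pmap N st ((\- f s) v).
Proof. by rewrite /= hom_natural linearN. Qed.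

Definition hom_opp M N (f : hom M N) : hom M N :=
  @Hom R P K M N (fun t => \- f t) (hom_opp_natural f).

Fact hom_zero_natural M N s t (st : val s <= val t) v :
  (\0 : M t -> N t) (pmap M st v) = pmap N st ((\0 : M s -> N s) v).
Proof. by rewrite /= linear0. Qed.

Definition hom_zero M N : hom M N :=
  @Hom R P K M N (fun t => \0) (@hom_zero_natural M N).

Lemma isomorphic_sym M N : isomorphic M N -> isomorphic N M.
Proof. by move=> [f [g [gf fg]]]; exists g, f. Qed.

Lemma isomorphic_trans M N L :
  isomorphic M N -> isomorphic N L -> isomorphic M L.
Proof.
move=> [f [f' [ff' f'f]]] [g [g' [gg' g'g]]].
exists (hom_comp g f), (hom_comp f' g'); split=> t v /=; first by rewrite gg' ff'.
by rewrite f'f g'g.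
Qed.

(** The inverse is chosen pointwise; injectivity of [f] then transfers linearity and naturality to
    it. *)
Lemma bij_is_iso M N (f : hom M N) :
  (forall t, injective (f t)) -> (forall t w, exists v, f t v = w) -> is_iso f.
Proof.
move=> finj fsurj; pose g t w := projT1 (cid (fsurj t w)).
have fg t w : f t (g t w) = w by exact: projT2 (cid (fsurj t w)).
have glin t : linear (g t) by move=> k u v; apply: (finj t); rewrite linearP !fg.
have gnat s t (st : val s <= val t) v :
    linear_of (glin t) (pmap N st v) = pmap M st (linear_of (glin s) v).
  by apply: (finj t); rewrite hom_natural /= !fg.
exists (@Hom R P K N M (fun t => linear_of (glin t)) gnat).
by split=> t v /=; [apply: (finj t); rewrite fg|exact: fg].
Qed.

Section Sum.
Variables (A : choiceType) (M_ : A -> pmod P K).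

Fact hom_proj_natural a s t (st : val s <= val t) v :
  dcoord a (pmap (pmod_sum M_) st v) = pmap (M_ a) st (dcoord a v).
Proof. by []. Qed.

Definition hom_proj a : hom (pmod_sum M_) (M_ a) :=
  @Hom R P K (pmod_sum M_) (M_ a) (fun t => @dcoord K A (fun b => M_ b t) a)
    (hom_proj_natural a).

Fact hom_inj_natural a s t (st : val s <= val t) v :
  @dinj K A (fun b => M_ b t) a (pmap (M_ a) st v) =
  pmap (pmod_sum M_) st (@dinj K A (fun b => M_ b s) a v).
Proof.
apply: dsumP => b; rewrite hom_proj_natural.
have [<-|ab] := eqVneq a b; first by rewrite !(@dcoord_inj K A (fun b => M_ b _)).
have z u (w : M_ a u) : dcoord b (@dinj K A (fun b => M_ b u) a w) = 0.
  exact: (@dcoord_inj_neq K A (fun b => M_ b u)).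
by rewrite !z linear0.
Qed.

Definition hom_inj a : hom (M_ a) (pmod_sum M_) :=
  @Hom R P K (M_ a) (pmod_sum M_) (fun t => linear_of (@dinj_linear K A (fun b => M_ b t) a))
    (@hom_inj_natural a).

End Sum.

Lemma isomorphic_sum (A : Type) (M_ N_ : A -> pmod P K) :
  (forall a, isomorphic (M_ a) (N_ a)) -> isomorphic (pmod_sum M_) (pmod_sum N_).
Proof.
move=> MN; have MN' a : {fg : hom (M_ a) (N_ a) * hom (N_ a) (M_ a) |
    (forall t v, fg.2 t (fg.1 t v) = v) /\ (forall t v, fg.1 t (fg.2 t v) = v)}.
  by apply: cid; have [f [g ?]] := MN a; exists (f, g).
have map_natural (L L' : A -> pmod P K) (f : forall a, hom (L a) (L' a)) s t
    (st : val s <= val t) v :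
    (dsum_map (fun a => f a t) : {linear _ -> _}) (pmap (pmod_sum L) st v) =
    pmap (pmod_sum L') st ((dsum_map (fun a => f a s) : {linear _ -> _}) v).
  apply: val_inj; apply: functional_extensionality_dep => a.
  exact: hom_natural.
exists (@Hom R P K (pmod_sum M_) (pmod_sum N_) _ (map_natural _ _ (fun a => (sval (MN' a)).1))).
exists (@Hom R P K (pmod_sum N_) (pmod_sum M_) _ (map_natural _ _ (fun a => (sval (MN' a)).2))).
by split=> t v; apply: val_inj; apply: functional_extensionality_dep => a;
  [exact: (svalP (MN' a)).1|exact: (svalP (MN' a)).2].
Qed.

(** Restricting coordinates along [h] forgets zero summands only. This allows two decompositions to
    be padded with zeros to a common index type. *)
Lemma isomorphic_reindex (A B : choiceType) (h : A -> B) (N_ : B -> pmod P K) :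
  injective h -> (forall b, ~ range h b -> is_zero (N_ b)) ->
  isomorphic (pmod_sum (N_ \o h)) (pmod_sum N_).
Proof.
move=> hinj N0; apply: isomorphic_sym.
have supp t (v : pmod_sum N_ t) :
    ((fun a => dcoord (h a) v) : dprod (fun a => N_ (h a) t)) \in
    @fin_supp K A (fun a => N_ (h a) t).
  apply/asboolP; apply: (@finite_preimage _ _ _ h _ (dcoord_supp v)) => a b _ _.
  exact: hinj.
pose f t v : pmod_sum (N_ \o h) t :=
  exist (fun g : dprod (fun a => N_ (h a) t) => g \in @fin_supp K A _) _ (supp t v).
have flin t : linear (f t) by move=> k u v; apply: val_inj.
have fnat s t (st : val s <= val t) v : linear_of (flin t) (pmap (pmod_sum N_) st v) =
    pmap (pmod_sum (N_ \o h)) st (linear_of (flin s) v).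
  by apply: val_inj.
exists (@Hom R P K (pmod_sum N_) (pmod_sum (N_ \o h)) _ fnat).
have fE t v a : dcoord a (f t v) = dcoord (h a) v by [].
apply: bij_is_iso => t.
  move=> v w /= vw; apply: dsumP => b.
  have [[a _ <-]|/N0 Nb0] := pselect (range h b); first by rewrite -!fE vw.
  by rewrite (Nb0 _ (dcoord b v)) (Nb0 _ (dcoord b w)).
move=> w /=.
exists (\sum_(a <- fset_set [set a | dcoord a w != 0])
  @dinj K B (fun b => N_ b t) (h a) (dcoord a w)).
rewrite -[f t]/(linear_of (flin t) : _ -> _) linear_sum/= [RHS]dsum_expand.
apply: eq_bigr => a _; apply: dsumP => b; rewrite fE.
have [<-|ab] := eqVneq a b; first by rewrite !dcoord_inj.
have hab : h a != h b by apply: contra_neq ab; exact: hinj.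
by rewrite (@dcoord_inj_neq K B (fun b => N_ b t) _ _ _ hab) dcoord_inj_neq.
Qed.

End Hom.

(** * Interval modules *)

Section IntervalModules.
Variables (R : realType) (P : set R) (K : fieldType).
Implicit Types (I J : convex_subset P) (s t : P).

Lemma convex_subset_eq I J : cset I = cset J -> I = J.
Proof.
case: I J => I Is Ic [J Js Jc] /= IJ.
by subst J; rewrite (Prop_irrelevance Is Js) (Prop_irrelevance Ic Jc).
Qed.

(* A vector of an interval module is a row of length 1 or 0; [icoord] and [ivec]
   identify it with a scalar, resp. with 0. *)
Definition icoord I t (v : interval_mod K I t) : K :=
  \sum_i (v : 'rV[K]_(val t \in cset I)) 0 i.

Definition ivec I t : interval_mod K I t :=
  (const_mx 1 : 'rV[K]_(val t \in cset I)).

Lemma icoord_linear I t : scalar (@icoord I t).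
Proof.
move=> k u v; rewrite /icoord mulr_sumr -big_split /=.
by apply: eq_bigr => i _; rewrite !mxE.
Qed.

HB.instance Definition _ I t :=
  GRing.isLinear.Build K (interval_mod K I t) K *%R (@icoord I t) (@icoord_linear I t).

Lemma icoordZ I t k (v : interval_mod K I t) : icoord (k *: v) = k * icoord v.
Proof. exact: linearZ. Qed.

Lemma icoordE I t (v : interval_mod K I t) : v = icoord v *: ivec I t.
Proof.
rewrite /icoord /ivec; move: v; rewrite /interval_mod /=.
case: (val t \in cset I) => v; apply/rowP => -[[|//] i] //=.
by rewrite big_ord1 !mxE mulr1; congr (v _ _); exact: val_inj.
Qed.

Lemma icoord_ivec I t : icoord (ivec I t) = (val t \in cset I)%:R.
Proof.
rewrite /icoord /ivec; case: (val t \in cset I); last by rewrite big_ord0.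
by rewrite big_ord1 mxE.
Qed.

Lemma icoord_notin I t (v : interval_mod K I t) : val t \notin cset I -> icoord v = 0.
Proof.
by move=> /negPf tI; rewrite [v]icoordE icoordZ icoord_ivec tI mulr0.
Qed.

Lemma icoord_eq0 I t (v : interval_mod K I t) : (icoord v == 0) = (v == 0).
Proof.
apply/eqP/eqP => [v0|->]; last exact: linear0.
by rewrite [v]icoordE v0 scale0r.
Qed.

Lemma icoord_pmap I s t (st : val s <= val t) (v : interval_mod K I s) :
  icoord (pmap (interval_mod K I) st v) = (val t \in cset I)%:R * icoord v.
Proof.
rewrite /icoord /=.
under eq_bigr => i _.
  rewrite mxE; under eq_bigr => j _ do rewrite mxE mulr1.
  over.
by rewrite sumr_const card_ord mulr_natl.
Qed.

Lemma interval_mod_zero I : is_zero (interval_mod K I) <-> cset I = set0.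
Proof.
split=> [I0|I0 t v].
  have [//|/set0P[x Ix]] := eqVneq (cset I) set0.
  have := I0 (exist _ x (mem_set (cset_sub Ix))) (ivec _ _).
  move=> /(congr1 (@icoord _ _)); rewrite icoord_ivec linear0 /= mem_set//.
  by move/eqP; rewrite oner_eq0.
by apply/eqP; rewrite -icoord_eq0 icoord_notin// I0 in_set0.
Qed.

Section Hom.
Variables (I J : convex_subset P) (f : hom (interval_mod K I) (interval_mod K J)).

(** At each point a map of interval modules is multiplication by a scalar; this is that scalar, and
    it is 0 outside the intersection of [I] and [J]. *)
Definition hcoef t : K := icoord (f t (ivec I t)).

Lemma icoord_hom t v : icoord (f t v) = icoord v * hcoef t.
Proof. by rewrite [in LHS](icoordE v) !linearZ. Qed.

Lemma hcoef_neq0_mem t : hcoef t != 0 -> val t \in cset I /\ val t \in cset J.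
Proof.
move=> ft; split; apply: contraNT ft => tI; last by rewrite /hcoef icoord_notin.
have i0 : ivec I t = 0 by apply/eqP; rewrite -icoord_eq0 icoord_notin.
by rewrite /hcoef i0 !linear0.
Qed.

Lemma hcoef_natural s t (st : val s <= val t) : val s \in cset I -> val t \in cset J ->
  (val t \in cset I)%:R * hcoef t = hcoef s.
Proof.
move=> sI tJ; have := hom_natural f st (ivec I s).
move/(congr1 (@icoord _ _)); rewrite icoord_hom !icoord_pmap icoord_ivec sI tJ.
by rewrite mulr1 mul1r.
Qed.

(** Naturality carries the nonzero coefficient at [t] down to [s], so [J] extends at least as far
    down as [I]. Dually, [hcoef_above] says that [I] extends at least as far up as [J]. *)
Lemma hcoef_below s t : val s <= val t -> hcoef t != 0 ->
  val s \in cset I -> val s \in cset J.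
Proof.
move=> st ft sI; have [tI tJ] := hcoef_neq0_mem ft.
have := hcoef_natural st sI tJ; rewrite tI mul1r => fst.
by rewrite fst in ft; have [] := hcoef_neq0_mem ft.
Qed.

Lemma hcoef_above s t : val s <= val t -> hcoef s != 0 ->
  val t \in cset J -> val t \in cset I.
Proof.
move=> st fs tJ; have [sI sJ] := hcoef_neq0_mem fs.
have := hcoef_natural st sI tJ; case: (val t \in cset I) => //.
by rewrite mul0r => /esym/eqP; rewrite (negPf fs).
Qed.

End Hom.

(** Each of the two maps yields half of each inclusion, one below [t] and one above. The separate
    [I'] admits two members of a family that are equal only propositionally. *)
Lemma hcoef_neq0_eq I J I' t (f : hom (interval_mod K I) (interval_mod K J))
    (g : hom (interval_mod K J) (interval_mod K I')) :
  I = I' -> hcoef f t != 0 -> hcoef g t != 0 -> I = J.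
Proof.
move=> II'; rewrite -{I'}II' in g * => ft gt; apply: convex_subset_eq.
apply/seteqP; split=> x Ix; have Px := mem_set (cset_sub Ix);
  pose s : P := exist _ x Px; apply: set_mem; rewrite -[x]/(val s);
  have {Ix}Is := mem_set Ix; have [xt|/ltW tx] := leP x (val t).
- exact: (hcoef_below (s := s) xt ft).
- exact: (hcoef_above (t := s) tx gt).
- exact: (hcoef_below (s := s) xt gt).
- exact: (hcoef_above (t := s) tx ft).
Qed.

(** The coefficient is constant on [I], because any two points are comparable and naturality links
    them; it is read off at one chosen point. *)
Lemma interval_end_scalar I (f : hom (interval_mod K I) (interval_mod K I)) :
  exists k, forall t v, f t v = k *: v.
Proof.
have [[x Ix]|I0] := pselect (cset I !=set0); last first.
  exists 0 => t v; have /interval_mod_zero Iz : cset I = set0.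
    by have [|/set0P] := eqVneq (cset I) set0.
  by rewrite (Iz _ v) linear0 scaler0.
pose s : P := exist _ x (mem_set (cset_sub Ix)).
have sI : val s \in cset I by exact: mem_set.
exists (hcoef f s) => t v; apply/eqP; rewrite -subr_eq0 -icoord_eq0 linearB linearZ /=.
rewrite icoord_hom (mulrC (hcoef f s)) -mulrBr.
have [tI|tI] := boolP (val t \in cset I); last first.
  by rewrite (icoord_notin _ tI) mul0r.
suff -> : hcoef f t = hcoef f s by rewrite subrr mulr0.
have [st|/ltW ts] := leP (val s) (val t).
  by have := hcoef_natural f st sI tI; rewrite tI mul1r.
by have := hcoef_natural f ts tI sI; rewrite sI mul1r.
Qed.

Lemma interval_local_end I : cset I !=set0 -> local_end (interval_mod K I).
Proof.
move=> I0; have nz : ~ is_zero (interval_mod K I).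
  by move=> /interval_mod_zero Ie; rewrite Ie in I0; case: I0.
split=> // f g; have [a fa] := interval_end_scalar f; have [b gb] := interval_end_scalar g.
have iso_scalar (h : hom (interval_mod K I) (interval_mod K I)) c :
    (forall t (v : interval_mod K I t), h t v = c *: v) -> ~ is_iso h -> c = 0.
  move=> hc niso; apply: contrapT => /eqP c0; apply: niso; apply: bij_is_iso => t.
    by move=> v w; rewrite !hc; exact: scalerI.
  by move=> w; exists (c^-1 *: w); rewrite hc scalerA mulfV ?scale1r.
move=> /(iso_scalar _ _ fa) a0 /(iso_scalar _ _ gb) b0 [h [hfg _]].
apply: nz => t v; rewrite -(hfg t v) /= fa gb a0 b0 !scale0r addr0 linear0.
by [].
Qed.

End IntervalModules.

(** * Uniqueness of interval decompositions *)

Section Azumaya.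
Variables (R : realType) (P : set R) (K : fieldType).
Implicit Types (M N : pmod P K) (I J : convex_subset P).

Lemma local_end_zero_not_iso M : local_end M -> ~ is_iso (hom_zero M M).
Proof.
move=> [nz _] [g [gz _]]; apply: nz => t v.
by rewrite -(gz t v) /= linear0.
Qed.

Definition hom_sum M N (s : seq (hom M N)) : hom M N :=
  foldr (@hom_add R P K M N) (hom_zero M N) s.

Lemma hom_sumE M N (T : Type) (F : T -> hom M N) (s : seq T) t v :
  hom_sum (map F s) t v = \sum_(i <- s) F i t v.
Proof.
by elim: s => [|i s IH]; rewrite ?big_nil ?big_cons //= -IH.
Qed.

Lemma local_end_sum M (T : Type) (F : T -> hom M M) (s : seq T) :
  local_end M -> is_iso (hom_sum (map F s)) -> exists i, is_iso (F i).
Proof.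
move=> locM isoF; apply: contrapT => noF.
elim: s isoF => [|i s IH] /=; first exact: local_end_zero_not_iso.
by apply: locM.2 => // iso_i; apply: noF; exists i.
Qed.

(* The idempotent f (g f)^-1 g of the interval module is a nonzero scalar. *)
Lemma retract_interval M I (f : hom M (interval_mod K I)) (g : hom (interval_mod K I) M) :
  ~ is_zero M -> is_iso (hom_comp g f) -> isomorphic M (interval_mod K I).
Proof.
move=> nz [h [hgf gfh]]; pose e := hom_comp f (hom_comp h g).
have [k ek] := interval_end_scalar e.
have k1 : k = 1.
  have ef t v : k *: f t v = f t v by rewrite -ek /= (hgf t v).
  apply/eqP; rewrite -subr_eq0; apply/negPn/negP => k0; apply: nz => t v.
  have fv0 : f t v = 0.
    by apply: (scalerI k0); rewrite scalerBl ef scale1r subrr scaler0.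
  by rewrite -(hgf t v) /= fv0 !linear0.
exists f, (hom_comp h g); split=> t v /=; first exact: hgf.
by have := ek t v; rewrite k1 scale1r.
Qed.

(** Azumaya's argument. The identity of [M_ a] is formally the sum of the maps through the summands
    [I b]. A finite part of that sum is shown to be an isomorphism, so by locality one term is, and
    [M_ a] is then a nonzero retract of an interval module. *)
Lemma local_summand_interval (A B : choiceType) (M_ : A -> pmod P K)
    (I : B -> convex_subset P) a :
  local_end (M_ a) ->
  isomorphic (pmod_sum M_) (pmod_sum (fun b => interval_mod K (I b))) ->
  exists b, isomorphic (M_ a) (interval_mod K (I b)).
Proof.
move=> locM [phi [psi [psiphi _]]].
have nz := locM.1.
pose f b : hom (M_ a) (interval_mod K (I b)) :=
  hom_comp (hom_proj _ b) (hom_comp phi (hom_inj _ a)).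
pose g b : hom (interval_mod K (I b)) (M_ a) :=
  hom_comp (hom_proj _ a) (hom_comp psi (hom_inj _ b)).
suff [b isob] : exists b, is_iso (hom_comp (g b) (f b)).
  by exists b; exact: retract_interval isob.
have [t [v v0]] : exists t (v : M_ a t), v <> 0.
  apply: contrapT => H; apply: nz => t v; apply: contrapT => v0.
  by apply: H; exists t, v.
pose w := phi t (hom_inj M_ a t v).
(* Only the finitely many summands that meet the image of one nonzero vector [v] are kept, so that
   [e] is a finite sum which still fixes [v]. *)
pose s : seq B := fset_set [set b | dcoord b w != 0].
pose e := hom_sum [seq hom_comp (g b) (f b) | b <- s].
have ev : e t v = v.
  have vE : v = hom_proj M_ a t (psi t w).
    by rewrite /w psiphi /= (@dcoord_inj K A (fun b => M_ b t)).
  rewrite hom_sumE [RHS]vE [w]dsum_expand.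
  by rewrite !linear_sum.
have [isoe|nisoe] := pselect (is_iso e); first exact: local_end_sum isoe.
(* [1 - e] kills [v], so it is not injective. If [e] were not invertible either, the identity would
   be a sum of two non-units. *)
have nisoe' : ~ is_iso (hom_add (hom_id (M_ a)) (hom_opp e)).
  move=> [h [hK _]]; apply: v0; rewrite -(hK t v) /= -[X in h t (v - X)]/(e t v) ev.
  by rewrite subrr linear0.
case: (locM.2 _ _ nisoe nisoe').
exists (hom_id _); split=> u x /=; by rewrite addrCA subrr addr0.
Qed.

End Azumaya.

(** * Multiplicity of an interval in a decomposition *)

Section Uniqueness.
Variables (R : realType) (P : set R) (K : fieldType) (A B : choiceType).
Variables (I : A -> convex_subset P) (J : B -> convex_subset P).

(** Exchange at a point [t] of [L]: the transported generators [eX] of the copies of [L] on the left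
    are independent modulo [W], and they lie in the span of [W] and of the generators [eY] on the
    right. Here [W] consists of the vectors that no map to a copy of [L] detects. *)
Lemma interval_multiplicity_le (L : convex_subset P) : cset L !=set0 ->
  isomorphic (pmod_sum (fun a => interval_mod K (I a)))
             (pmod_sum (fun b => interval_mod K (J b))) ->
  ([set a | I a = L] #<= [set b | J b = L])%card.
Proof.
move=> [x Lx] [phi [psi [psiphi _]]].
pose t : P := exist _ x (mem_set (cset_sub Lx)).
have tL : val t \in cset L by exact: mem_set.
pose X := set_type [set a | I a = L]; pose Y := set_type [set b | J b = L].
have IX (i : X) : I (val i) = L by have := set_mem (valP i).
pose V := pmod_sum (fun b => interval_mod K (J b)) t.
pose W : set V := [set w | forall (i : X) (g : hom _ (interval_mod K (I (val i)))),
  g t w = 0].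
pose eX (i : X) : V := phi t (hom_inj _ (val i) t (ivec K (I (val i)) t)).
pose eY (j : Y) : V := hom_inj _ (val j) t (ivec K (J (val j)) t).
suff [h hinj] : exists h : X -> Y, injective h.
  by apply/card_leP/injfunPex; exists h => // i j _ _; exact: hinj.
apply: (@free_mod_le_span K V W X Y eX eY) => i.
  (* Independence: the projection to the summand [i] kills [W] and the other generators, but not
     [eX i]. *)
  move=> spani; pose g := hom_comp (hom_proj _ (val i)) psi.
  have : [set w : V | g t w = 0] (eX i).
    apply: spani; first split=> [|k u v gu gv]; first exact: linear0.
      by apply: etrans (linearP (g t) k u v) _; rewrite [g t u]gu [g t v]gv scaler0 addr0.
    move=> w [Ww|[j ji <-]] /=; first exact: (Ww i g).
    rewrite psiphi /=; apply: (@dcoord_inj_neq K A (fun a => interval_mod K (I a) t)).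
    by apply/eqP => jiE; apply: ji; exact: val_inj.
  rewrite /= psiphi /= (@dcoord_inj K A (fun a => interval_mod K (I a) t)).
  have ti : val t \in cset (I (val i)) by rewrite IX.
  have i0 : icoord (0 : interval_mod K (I (val i)) t) = 0 by exact: linear0.
  move=> H; have := etrans (congr1 (@icoord R P K (I (val i)) t) H) i0.
  by rewrite icoord_ivec ti => /eqP; rewrite oner_eq0.
apply: span_dsum => b eXib.
have [JbL|JbL] := pselect (J b = L).
  rewrite [dcoord b _]icoordE linearZ /=; apply: submoduleZ (span_submodule _) _.
  apply: sub_span; right; exists (exist _ b (mem_set JbL)) => //.
(* The component of [eX i] in a summand different from [L] lies in [W]: a map to a copy of [L] that
   detects it would give maps from [L] to [J b] and back, both nonzero at [t], which forces
   [J b = L]. *)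
apply: sub_span; left => j g; apply: contrapT => /eqP gb; apply: JbL.
pose f := hom_comp (hom_proj _ b) (hom_comp phi (hom_inj _ (val i))).
pose g' := hom_comp g (hom_inj _ b).
rewrite -(IX i); apply/esym.
apply: (@hcoef_neq0_eq _ _ _ (I (val i)) (J b) (I (val j)) t f g').
- by rewrite !IX.
- by rewrite /hcoef icoord_eq0.
apply: contraNneq gb => g'0.
by rewrite -[g t _]/(g' t (dcoord b (eX i))) -icoord_eq0 icoord_hom g'0 mulr0.
Qed.

End Uniqueness.

(** For each [L] the two inequalities of multiplicities yield a bijection by Cantor-Bernstein, and
    [s] glues these together. Some [J b] may be empty, so [s] is onto the nonempty ones only. *)
Lemma interval_decomposition_unique (R : realType) (P : set R) (K : fieldType)
    (A B : choiceType) (I : A -> convex_subset P) (J : B -> convex_subset P) :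
  (forall a, cset (I a) !=set0) ->
  isomorphic (pmod_sum (fun a => interval_mod K (I a)))
             (pmod_sum (fun b => interval_mod K (J b))) ->
  exists s : A -> B, [/\ injective s, forall a, J (s a) = I a &
    forall b, cset (J b) !=set0 -> range s b].
Proof.
move=> I0 IJ.
have bijP (L : convex_subset P) : exists h : [set a | I a = L] -> [set b | J b = L],
    cset L !=set0 -> bijective h.
  have [L0|L0] := pselect (cset L !=set0).
    have /card_bijP[h hb] : ([set a | I a = L] #= [set b | J b = L])%card.
      rewrite card_eq_le; apply/andP; split; apply: (@interval_multiplicity_le R P K) => //.
      exact: isomorphic_sym.
    by exists h.
  (* For empty [L] the domain is empty, so a map still exists; thus [h] can be chosen for all [L] at
     once. *)
  have nope (a : [set a | I a = L]) : False.
    by have /= IL := set_mem (valP a); apply: L0; rewrite -IL.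
  by exists (fun a => False_rect _ (nope a)).
pose h L := projT1 (cid (bijP L)).
have hbij L : cset L !=set0 -> bijective (h L) by exact: projT2 (cid (bijP L)).
pose s a := val (h (I a) (exist _ a (mem_set erefl))).
have sI a : J (s a) = I a by have := set_mem (valP (h (I a) (exist _ a (mem_set erefl)))).
exists s; split=> // [a b sab|b Jb0].
  have Iab : I a = I b by rewrite -sI sab sI.
  have h_inj L L' (p : [set a | I a = L]) (q : [set a | I a = L']) : L = L' ->
      cset L !=set0 -> val (h L p) = val (h L' q) -> val p = val q.
    move=> LL' L0; subst L' => /val_inj hpq.
    by rewrite (bij_inj (hbij _ L0) hpq).
  exact: (h_inj _ _ _ _ Iab (I0 a) sab).
have [g _ gh] := hbij _ Jb0; pose c := g (exist _ b (mem_set erefl)).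
have Ic : I (val c) = J b by exact: set_mem (valP c).
have h_val L L' (p : [set a | I a = L]) (q : [set a | I a = L']) : L = L' ->
    val p = val q -> val (h L p) = val (h L' q).
  by move=> LL'; subst L' => /val_inj ->.
exists (val c) => //.
by apply: etrans (h_val _ _ _ c Ic _) _; rewrite // /c gh.
Qed.

(** * Canonical maps between interval modules *)

Section DimQuo.
Variables (R : realType) (K : fieldType) (V : lmodType K).
Implicit Types U W : set V.
Local Open Scope ereal_scope.

Lemma dim_quo_ge0 U W : 0 <= dim_quo R U W.
Proof. by apply/ereal_infP => _ [n _ <-]; rewrite lee_fin ler0n. Qed.

Lemma dim_quo_eq0 U W : U `<=` W -> dim_quo R U W = 0.
Proof.
move=> UW; apply/le_anti; rewrite dim_quo_ge0 andbT; apply: ge_ereal_inf.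
exists 0 => //; exists 0%N => //; exists (fun=> 0%R); split=> [[]//|v Uv].
exists 0%R; split=> [|c _]; last by apply/rowP => -[].
by rewrite big_ord0 subr0; exact: UW.
Qed.

(** The infimum is over natural numbers, so a value below 1 comes from an empty basis. *)
Lemma dim_quo_lt1 U W : dim_quo R U W < 1 -> U `<=` W.
Proof.
move=> /ereal_inf_lt[_ [[|n] [e [_ eW]] <-]]; last by rewrite lte_fin ltrn1.
by move=> _ v /eW[c [+ _]]; rewrite big_ord0 subr0.
Qed.

Lemma dim_quo_eq1 U W e : U e -> ~ (U `<=` W) ->
  (forall v, U v -> exists! c : K, W (v - c *: e)%R) -> dim_quo R U W = 1.
Proof.
move=> Ue UW eW; apply/le_anti/andP; split.
  apply: ge_ereal_inf; exists 1 => //; exists 1%N => //.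
  exists (fun=> e); split=> // v /eW[c [Wc cuniq]]; exists (const_mx c); split.
    by rewrite big_ord1 mxE.
  by move=> d; rewrite big_ord1 => /cuniq ->; apply/rowP => i; rewrite mxE (ord1 i).
by rewrite leNgt; apply/negP => /dim_quo_lt1.
Qed.

End DimQuo.

(** * The canonical map with its kernel and cokernel *)

Section CanonicalHom.
Variables (R : realType) (P : set R) (K : fieldType) (I J : convex_subset P).

Lemma icoord_inj (L : convex_subset P) (t : P) : injective (@icoord R P K L t).
Proof. by move=> v w vw; rewrite (icoordE v) (icoordE w) vw. Qed.

(** The identity of [K] on the intersection of [I] and [J], zero elsewhere. The hypothesis [IJ]
    below makes this natural in [t]. *)
Definition chom_fun (t : P) (v : interval_mod K I t) : interval_mod K J t :=
  icoord v *: ivec K J t.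

Lemma chom_linear t : linear (@chom_fun t).
Proof. by move=> k u v; rewrite /chom_fun linearP scalerDl scalerA. Qed.

Hypothesis IJ : forall s t : P, val s <= val t ->
  val s \in cset I -> val t \in cset J -> (val s \in cset J) = (val t \in cset I).

Fact chom_natural (s t : P) (st : val s <= val t) (v : interval_mod K I s) :
  linear_of (@chom_linear t) (pmap (interval_mod K I) st v) =
  pmap (interval_mod K J) st (linear_of (@chom_linear s) v).
Proof.
apply: icoord_inj; rewrite icoord_pmap !(linear_ofE (@chom_linear _)) /chom_fun.
rewrite !icoordZ icoord_pmap !icoord_ivec.
have [tJ|tJ] := boolP (val t \in cset J); last by rewrite !mul0r ?mulr0.
have [sI|sI] := boolP (val s \in cset I); last by rewrite icoord_notin// !(mulr0, mul0r).
by rewrite (IJ st sI tJ) mulr1 mul1r mulrC.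
Qed.

Definition chom : hom (interval_mod K I) (interval_mod K J) :=
  @Hom R P K _ _ (fun t => linear_of (@chom_linear t)) chom_natural.

Lemma icoord_chom t v : icoord (chom t v) = icoord v * (val t \in cset J)%:R.
Proof. by rewrite [LHS]icoordZ icoord_ivec. Qed.

(** On the points of [I] outside [J] the map goes from [K] to 0; elsewhere the source is 0 or the
    map is the identity. *)
Lemma dim_quo_ker_chom t :
  dim_quo R [set v | chom t v = 0] [set 0] = (\1_(cset I `\` cset J) (val t))%:E.
Proof.
rewrite indicE; have [tIJ|tIJ] := boolP (val t \in cset I `\` cset J).
  have [/mem_set tI tJ] := set_mem tIJ.
  have tJ0 : (val t \in cset J) = false by apply/negP => /set_mem.
  have c0 v : chom t v = 0 by apply: icoord_inj; rewrite icoord_chom tJ0 mulr0 linear0.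
  have i1 : icoord (ivec K I t) = 1 by rewrite icoord_ivec tI.
  apply: (@dim_quo_eq1 R K _ _ _ (ivec K I t)) => //.
    move=> /(_ (ivec K I t) (c0 _)) iv0; have := oner_neq0 K.
    by rewrite -i1 icoord_eq0 iv0 eqxx.
  move=> v _; exists (icoord v); split=> [|c /eqP].
    by apply/eqP; rewrite subr_eq0; apply/eqP; exact: icoordE.
  by rewrite subr_eq0 => /eqP ->; rewrite icoordZ i1 mulr1.
rewrite dim_quo_eq0// => v /= /(congr1 (@icoord _ _ _ _ _)).
rewrite icoord_chom linear0 => /eqP; rewrite mulf_eq0 icoord_eq0 => /orP[/eqP//|tJ].
apply/eqP; rewrite -icoord_eq0 icoord_notin//; apply: contra tIJ => tI.
rewrite inE; split; first exact: set_mem.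
by move=> /mem_set tJ'; move: tJ; rewrite tJ' oner_eq0.
Qed.

Lemma dim_quo_coker_chom t :
  dim_quo R setT (range (chom t)) = (\1_(cset J `\` cset I) (val t))%:E.
Proof.
rewrite indicE; have [tJI|tJI] := boolP (val t \in cset J `\` cset I).
  have [/mem_set tJ tI] := set_mem tJI.
  have rng w : range (chom t) w -> w = 0.
    move=> [v _ <-]; apply: icoord_inj; rewrite icoord_chom linear0 icoord_notin ?mul0r//.
    by apply/negP => /set_mem.
  have rng0 : range (chom t) 0 by exists 0 => //; rewrite linear0.
  have i1 : icoord (ivec K J t) = 1 by rewrite icoord_ivec tJ.
  apply: (@dim_quo_eq1 R K _ _ _ (ivec K J t)) => //.
    move=> /(_ (ivec K J t) Logic.I) /rng iv0; have := oner_neq0 K.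
    by rewrite -i1 icoord_eq0 iv0 eqxx.
  move=> v _; exists (icoord v); split=> [|c /rng /eqP].
    by rewrite -icoordE subrr.
  by rewrite subr_eq0 => /eqP ->; rewrite icoordZ i1 mulr1.
rewrite dim_quo_eq0// => w _; exists (icoord w *: ivec K I t) => //.
apply: icoord_inj; rewrite icoord_chom icoordZ icoord_ivec.
have [tJ|tJ] := boolP (val t \in cset J); last by rewrite mulr0 icoord_notin.
suff -> : val t \in cset I by rewrite !mulr1.
apply: contraNT tJI => tI; rewrite inE; split; first exact: set_mem.
by move=> /mem_set; apply/negP.
Qed.

End CanonicalHom.

(** * The path distance *)

Section PathDistance.
Variables (R : realType) (P : set R) (S : set_system R).
Hypothesis hS : sigma_algebra P S.
Variable mu : {measure set (g_sigma_algebraType S) -> \bar R}.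
Hypothesis hI : forall I : convex_subset P, cset I !=set0 -> S (cset I).
Variable K : fieldType.
Local Notation T := (g_sigma_algebraType S).
Local Open Scope ereal_scope.

Local Notation dker f := (@dim_ker R P S K _ _ f).
Local Notation dcoker f := (@dim_coker R P S K _ _ f).

Lemma measurable_sigma (E : set T) : S E -> measurable E.
Proof. exact: sub_sigma_algebra. Qed.

Lemma measurable_domain : measurable (P : set T).
Proof. by apply: measurable_sigma; case: hS => S0 SD _; rewrite -[P]setD0; exact: SD. Qed.

Lemma measurable_convex (I : convex_subset P) : measurable (cset I : set T).
Proof.
have [->|/set0P/hI] := eqVneq (cset I) set0; first exact: measurable0.
exact: measurable_sigma.
Qed.

Lemma valL_in (f : P -> \bar R) (t : P) : 'valL_ 0 f (val t) = f t.
Proof. by have /(congr1 (@^~ t)) := valLK 0 f. Qed.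

Lemma dim_ker_ge0 (M N : pmod P K) (f : hom M N) x : P x -> 0 <= dker f x.
Proof. by move=> Px; rewrite /dim_ker (valL_in _ (exist _ x (mem_set Px))) dim_quo_ge0. Qed.

Lemma dim_coker_ge0 (M N : pmod P K) (f : hom M N) x : P x -> 0 <= dcoker f x.
Proof. by move=> Px; rewrite /dim_coker (valL_in _ (exist _ x (mem_set Px))) dim_quo_ge0. Qed.

Lemma integrable_indic_lty (E : set T) : measurable E -> mu E < +oo ->
  mu.-integrable P (EFin \o \1_E).
Proof.
move=> mE Eoo; apply/integrableP; split.
  by apply/measurable_EFinP; exact: measurable_indic.
under eq_integral => x _ do rewrite /= ger0_norm ?ler0n//.
rewrite integral_indic//; last exact: measurable_domain.
apply: le_lt_trans Eoo; apply: le_measure; rewrite ?inE//.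
by apply: measurableI => //; exact: measurable_domain.
Qed.

(** * Cost of the canonical map *)

Section CanonicalCost.
Variables (I J : convex_subset P).
Hypothesis IJ : forall s t : P, (val s <= val t)%R ->
  val s \in cset I -> val t \in cset J -> (val s \in cset J) = (val t \in cset I).

Let measD (L L' : convex_subset P) : measurable (cset L `\` cset L' : set T).
Proof. by apply: measurableD; exact: measurable_convex. Qed.

Let integral_indicD (L L' : convex_subset P) :
  \int[mu]_(t in P) (\1_(cset L `\` cset L') t)%:E = mu (cset L `\` cset L').
Proof.
rewrite integral_indic//; last exact: measurable_domain.
by rewrite setIidl// => x [/cset_sub].
Qed.

Lemma dim_ker_chom :
  {in (P : set T), dker (chom K IJ) =1 (EFin \o \1_(cset I `\` cset J))}.
Proof.
move=> x /set_mem Px; rewrite /dim_ker (valL_in _ (exist _ x (mem_set Px))).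
exact: dim_quo_ker_chom.
Qed.

Lemma dim_coker_chom :
  {in (P : set T), dcoker (chom K IJ) =1 (EFin \o \1_(cset J `\` cset I))}.
Proof.
move=> x /set_mem Px; rewrite /dim_coker (valL_in _ (exist _ x (mem_set Px))).
exact: dim_quo_coker_chom.
Qed.

Lemma cost_chom : cost mu (chom K IJ) = mu (cset I `\` cset J) + mu (cset J `\` cset I).
Proof.
by rewrite /cost (eq_integral _ _ dim_ker_chom) (eq_integral _ _ dim_coker_chom) !integral_indicD.
Qed.

Lemma admissible_chom : mu (cset I `\` cset J) < +oo -> mu (cset J `\` cset I) < +oo ->
  admissible mu (chom K IJ).
Proof.
move=> IJoo JIoo; split.
- apply: (eq_integrable measurable_domain (EFin \o \1_(cset I `\` cset J))).
    by move=> x Px; rewrite dim_ker_chom.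
  exact: integrable_indic_lty.
- apply: (eq_integrable measurable_domain (EFin \o \1_(cset J `\` cset I))).
    by move=> x Px; rewrite dim_coker_chom.
  exact: integrable_indic_lty.
Qed.

End CanonicalCost.

(** * Upper bound for the path distance *)

Section UpperBound.
Variables (I J : convex_subset P).

(** For intervals that meet, this runs from the later start to the later end; for disjoint intervals
    it is the upper one. *)
Let L0 : set R := [set x | (cset I x \/ cset J x) /\
  (exists2 i, cset I i & (i <= x)%R) /\ (exists2 j, cset J j & (j <= x)%R)].

Let L0_sub : L0 `<=` P. Proof. by move=> x [[]/cset_sub]. Qed.

Let L0_convex x y z : L0 x -> L0 z -> P y -> (x <= y)%R -> (y <= z)%R -> L0 y.
Proof.
move=> [_ [[i Ii ix] [j Jj jx]]] [zIJ _] Py xy yz.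
have iy := le_trans ix xy; have jy := le_trans jx xy.
split; last by split; [exists i|exists j].
case: zIJ => [Iz|Jz]; [left; exact: cset_convex Ii Iz Py iy yz|].
by right; exact: cset_convex Jj Jz Py jy yz.
Qed.

Let L := ConvexSubset L0_sub L0_convex.

Let LI (s t : P) : (val s <= val t)%R -> val s \in cset L -> val t \in cset I ->
  (val s \in cset I) = (val t \in cset L).
Proof.
move=> st /set_mem[_ [[i Ii ix] [j Jj jx]]] /set_mem It.
rewrite !mem_set//; last exact: cset_convex Ii It (set_mem (valP s)) ix st.
split; first by left.
by split; [exists i|exists j] => //; exact: le_trans st.
Qed.

Let LJ (s t : P) : (val s <= val t)%R -> val s \in cset L -> val t \in cset J ->
  (val s \in cset J) = (val t \in cset L).
Proof.
move=> st /set_mem[_ [[i Ii ix] [j Jj jx]]] /set_mem Jt.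
rewrite !mem_set//; last exact: cset_convex Jj Jt (set_mem (valP s)) jx st.
split; first by right.
by split; [exists i|exists j] => //; exact: le_trans st.
Qed.

(* The upper envelope L of I and J maps canonically to both, and the symmetric
   differences of L with I and J partition that of I and J. *)
Lemma path_dist_interval_le :
  path_dist mu (interval_mod K I) (interval_mod K J) <= mu (cset I `+` cset J).
Proof.
have mD (L1 L2 : convex_subset P) : measurable (cset L1 `\` cset L2 : set T).
  by apply: measurableD; exact: measurable_convex.
have LsI x : cset L x -> ~ cset I x -> cset J x by move=> [[]].
have LsJ x : cset L x -> ~ cset J x -> cset I x by move=> [[]].
have IsL x : cset I x -> ~ cset L x -> ~ cset J x.
  move=> Ix nLx Jx; apply: nLx; split; first by left.
  by split; exists x.
have JsL x : cset J x -> ~ cset L x -> ~ cset I x.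
  by move=> Jx nLx Ix; exact: IsL nLx Jx.
have IJE : cset I `\` cset J = (cset I `\` cset L) `|` (cset L `\` cset J).
  apply/seteqP; split=> x; last by move=> [[Ix nLx]|[Lx nJx]]; split; eauto.
  by move=> [Ix nJx]; have [Lx|nLx] := pselect (cset L x); [right|left].
have JIE : cset J `\` cset I = (cset J `\` cset L) `|` (cset L `\` cset I).
  apply/seteqP; split=> x; last by move=> [[Jx nLx]|[Lx nIx]]; split; eauto.
  by move=> [Jx nIx]; have [Lx|nLx] := pselect (cset L x); [right|left].
(* Admissibility requires finite integrals, so the infinite case, where the bound is trivial, is set
   apart. *)
have [->|] := eqVneq (mu (cset I `+` cset J)) +oo; first exact: leey.
rewrite -ltey => Coo.
have sub_oo (E : set T) : measurable E -> E `<=` cset I `+` cset J -> mu E < +oo.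
  move=> mE EIJ; apply: le_lt_trans Coo; apply: le_measure; rewrite ?inE//.
  by apply: measurableU; exact: mD.
have ILoo : mu (cset I `\` cset L) < +oo.
  by apply: sub_oo => //; rewrite /setY IJE => x; left; left.
have LIoo : mu (cset L `\` cset I) < +oo.
  by apply: sub_oo => //; rewrite /setY JIE => x; right; right.
have JLoo : mu (cset J `\` cset L) < +oo.
  by apply: sub_oo => //; rewrite /setY JIE => x; right; left.
have LJoo : mu (cset L `\` cset J) < +oo.
  by apply: sub_oo => //; rewrite /setY IJE => x; left; right.
have -> : mu (cset I `+` cset J) = cost mu (chom K LI) + (cost mu (chom K LJ) + 0).
  rewrite adde0 !cost_chom /setY measureU//; last first.
    by apply/seteqP; split=> // x [[Ix _] [_ /(_ Ix)]].
  rewrite IJE JIE !measureU//; last 2 first.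
  - by apply/seteqP; split=> // x [[_ nLx] [/nLx]].
  - by apply/seteqP; split=> // x [[_ nLx] [/nLx]].
  rewrite (addeC (mu (cset I `\` _))) (addeC (mu (cset J `\` _))) [RHS]addeACA.
  by rewrite (addeC (mu (cset L `\` cset I)) (mu (cset L `\` cset J))) [RHS]addeACA.
apply: ereal_inf_lbound.
apply: zigzag_back; first exact: admissible_chom.
by apply: zigzag_forth; [exact: admissible_chom|exact: zigzag_nil].
Qed.

End UpperBound.

(** Dimensions are natural numbers or infinite, so a defect below 1 means that [f] is bijective at
    [t]. *)
Lemma admissible_bij (M N : pmod P K) (f : hom M N) (t : P) :
  dker f (val t) + dcoker f (val t) < 1 ->
  (forall v : M t, v = 0%R) <-> (forall v : N t, v = 0%R).
Proof.
rewrite /dim_ker /dim_coker !valL_in => f1.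
have /dim_quo_lt1 ker0 : dim_quo R [set v | f t v = 0%R] [set 0%R] < 1.
  by apply: le_lt_trans f1; rewrite leeDl// dim_quo_ge0.
have /dim_quo_lt1 coker0 : dim_quo R setT (range (f t)) < 1.
  by apply: le_lt_trans f1; rewrite leeDr// dim_quo_ge0.
split=> [M0 w|N0 v]; last exact: ker0.
by have [v _ <-] := coker0 w Logic.I; rewrite (M0 v) linear0.
Qed.

Lemma admissible_integral (M N : pmod P K) (f : hom M N) : admissible mu f ->
  measurable_fun (P : set T) (fun x => dker f x + dcoker f x) /\
  \int[mu]_(x in P) (dker f x + dcoker f x) = cost mu f.
Proof.
move=> [/measurable_int mk /measurable_int mc]; split; first exact: emeasurable_funD.
rewrite ge0_integralD//; first exact: measurable_domain.
- by move=> x; exact: dim_ker_ge0.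
- by move=> x; exact: dim_coker_ge0.
Qed.

(* Along a zigzag all modules vanish at t simultaneously unless some map has a
   nonzero kernel or cokernel at t, in which case the total defect is >= 1. *)
Lemma zigzag_defect (M N : pmod P K) c : zigzag mu M N c ->
  exists g : T -> \bar R, [/\ measurable_fun (P : set T) g,
    forall x, P x -> 0 <= g x, \int[mu]_(x in P) g x = c &
    forall t : P, g (val t) < 1 ->
      (forall v : M t, v = 0%R) <-> (forall v : N t, v = 0%R)].
Proof.
have step (M1 N1 : pmod P K) (f : hom M1 N1) (g : T -> \bar R) e : admissible mu f ->
    measurable_fun (P : set T) g -> (forall x, P x -> 0 <= g x) ->
    \int[mu]_(x in P) g x = e ->
    let h := (fun x => dker f x + dcoker f x) \+ g in
    [/\ measurable_fun (P : set T) h, forall x, P x -> 0 <= h x,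
      \int[mu]_(x in P) h x = cost mu f + e &
      forall t : P, h (val t) < 1 -> g (val t) < 1 /\ dker f (val t) + dcoker f (val t) < 1].
  move=> /admissible_integral[mf If] mg g0 <- h.
  have f0 x : P x -> 0 <= dker f x + dcoker f x.
    by move=> Px; rewrite adde_ge0// ?dim_ker_ge0 ?dim_coker_ge0.
  split; first exact: emeasurable_funD.
  - by move=> x Px; rewrite adde_ge0// ?f0 ?g0.
  - by rewrite ge0_integralD// ?If//; exact: measurable_domain.
  - move=> t h1; have Pt := set_mem (valP t); split; apply: le_lt_trans h1.
      by rewrite leeDr// f0.
    by rewrite leeDl// g0.
elim=> {M N c} [M|M M' N f c fadm _ [g [mg g0 gc gt]]|M M' N f c fadm _ [g [mg g0 gc gt]]].
- exists (cst 0); split=> //; exact: integral0.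
- have [mh h0 hc ht] := step _ _ f g _ fadm mg g0 gc; eexists; split; [exact: mh| | |] => //.
  by move=> t /ht[/gt <- /admissible_bij].
- have [mh h0 hc ht] := step _ _ f g _ fadm mg g0 gc; eexists; split; [exact: mh| | |] => //.
  by move=> t /ht[/gt <- /admissible_bij ->].
Qed.

(** At a point of the symmetric difference exactly one end of the zigzag vanishes, so the defect
    function is at least 1 there; integrating gives the bound. *)
Lemma path_dist_ge (M N : pmod P K) (I J : convex_subset P) :
  isomorphic M (interval_mod K I) -> isomorphic N (interval_mod K J) ->
  mu (cset I `+` cset J) <= path_dist mu M N.
Proof.
have vanish M1 (I1 : convex_subset P) (t : P) : isomorphic M1 (interval_mod K I1) ->
    (forall v : M1 t, v = 0%R) <-> ~ cset I1 (val t).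
  move=> [f [g [gf fg]]]; split=> [M0 It|It v].
    have := oner_neq0 K; have <- : icoord (ivec K I1 t) = 1%R by rewrite icoord_ivec mem_set.
    by rewrite icoord_eq0 -(fg t (ivec K I1 t)) (M0 (g t _)) linear0 eqxx.
  rewrite -(gf t v); suff -> : f t v = 0%R by rewrite linear0.
  by apply/eqP; rewrite -icoord_eq0 icoord_notin//; apply/negP => /set_mem.
move=> MI NJ; apply/ereal_infP => c /zigzag_defect[g [mg g0 <- gt]].
have mIJ : measurable (cset I `+` cset J : set T).
  by apply: measurableU; apply: measurableD; exact: measurable_convex.
have IJP : cset I `+` cset J `<=` P by move=> x [[/cset_sub]|[/cset_sub]].
rewrite -[X in mu X](setIidl IJP) -integral_indic//; last exact: measurable_domain.
apply: ge0_le_integral => //.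
- exact: measurable_domain.
- by apply/measurable_EFinP; exact: measurable_indic.
move=> x Px; rewrite indicE; have [/set_mem xIJ|_] := boolP (x \in _); last exact: g0.
rewrite leNgt; apply/negP; pose t : P := exist _ x (mem_set Px).
move=> /(gt t); rewrite (vanish _ _ t MI) (vanish _ _ t NJ) /=.
by case: xIJ => -[]; tauto.
Qed.

End PathDistance.

(** * Diagram points and measures *)

Section Diagrams.
Variables (R : realType) (P : set R) (S : set_system R).
Variable mu : {measure set (g_sigma_algebraType S) -> \bar R}.
Local Open Scope ereal_scope.
Hypothesis hmu : forall I : convex_subset P, cset I !=set0 ->
  S (cset I) /\
  mu (cset I) = ereal_inf (EFin @` above P (cset I)) - ereal_inf (EFin @` cset I).
Local Notation T := (g_sigma_algebraType S).
Implicit Types (I J : convex_subset P) (a b c d : \bar R).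

Lemma abse_distC a b : `|a - b| = `|b - a|.
Proof. by case: a b => [a| |] [b| |] //=; rewrite distrC. Qed.

Lemma absdiffC a b : absdiff a b = absdiff b a.
Proof. by rewrite /absdiff eq_sym; case: ifP => // _; rewrite abse_distC. Qed.

Lemma absdiff_ge0 a b : 0 <= absdiff a b.
Proof. by rewrite /absdiff; case: ifP. Qed.

(** Finiteness of one argument rules out equal infinite ones, where [absdiff] is 0 but [b - a] is
    not. *)
Lemma absdiff_le a b : a <= b -> a \is a fin_num \/ b \is a fin_num ->
  absdiff a b = b - a.
Proof.
rewrite /absdiff; have [-> _ [] bf|ab] := eqVneq a b; try by rewrite subee.
rewrite le_eqVlt (negPf ab) /= => {}ab _; rewrite abse_distC.
case: a b ab => [a| |] [b| |] //= ab.
by rewrite ger0_norm// subr_ge0; exact: ltW.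
Qed.

Lemma dist1_ge0 (x y : \bar R * \bar R) : 0 <= dist1 x y.
Proof. by rewrite adde_ge0 ?absdiff_ge0. Qed.

Lemma absdiff_triangle a b c : a < b -> b - a <= absdiff a c + absdiff b c.
Proof.
rewrite /absdiff; case: a b c => [a| |] [b| |] [c| |] //=; rewrite ?eqxx ?leey//;
  try by case: ifP.
rewrite lte_fin => ab; rewrite !eqe.
have [->|_] := eqVneq a c; have [->|_] := eqVneq b c.
- by rewrite adde0 EFinN subee.
- rewrite add0e lee_fin; exact: ler_norm.
- by rewrite adde0 lee_fin distrC ler_norm.
rewrite -EFinD lee_fin (_ : (b - a = (c - a) + (b - c))%R); last by rewrite [RHS]addrC subrKA.
by rewrite (distrC a) lerD ?ler_norm.
Qed.

(** The diagonal point with both coordinates [a] attains the distance, and the triangle inequality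
    shows that no other does better. *)
Lemma dist_diag_le a b : a <= b -> a < +oo -> -oo < b -> dist_diag (a, b) = b - a.
Proof.
move=> ab aoo boo.
have abE : absdiff b a = b - a.
  move: ab; rewrite le_eqVlt => /orP[/eqP ab|ab]; rewrite absdiffC.
    apply: absdiff_le; first by rewrite ab.
    by left; move: boo aoo; rewrite -ab; case: a {ab} => [a| |].
  rewrite /absdiff lt_eqF// abse_distC; case: a b ab {aoo boo} => [a| |] [b| |] //= ab.
  by rewrite ger0_norm// subr_ge0; exact: ltW.
apply/le_anti/andP; split.
  apply: ge_ereal_inf; exists (dist1 (a, b) (a, a)); first by exists (a, a).
  by rewrite /dist1 /= abE /absdiff eqxx add0e.
apply/ereal_infP => _ [[y1 y2] /= -> <-]; rewrite /dist1 /=.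
move: ab; rewrite le_eqVlt => /orP[/eqP ab|ab]; last exact: absdiff_triangle.
by rewrite -abE -ab {1}/absdiff eqxx adde_ge0 ?absdiff_ge0.
Qed.

Let lo (I : set R) := ereal_inf (EFin @` I).
Let hi (I : set R) := ereal_inf (EFin @` above P I).

Let lo_le (I : set R) x : I x -> lo I <= x%:E.
Proof. by move=> Ix; apply: ereal_inf_lbound; exists x. Qed.

Let hi_ge (I : set R) x : I x -> x%:E <= hi I.
Proof. by move=> Ix; apply/ereal_infP => _ [y [_ /(_ x Ix) /ltW xy] <-]; rewrite lee_fin. Qed.

Lemma dist_diag_dgm_point I : cset I !=set0 ->
  dist_diag (dgm_point P (cset I)) = mu (cset I).
Proof.
move=> I0; have [_ ->] := hmu I0; have [x Ix] := I0.
apply: dist_diag_le; first exact: le_trans (lo_le Ix) (hi_ge Ix).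
- exact: le_lt_trans (lo_le Ix) (ltry x).
- exact: lt_le_trans (ltNyr x) (hi_ge Ix).
Qed.

(** * The two parts of the difference of intervals that meet *)

Section Parts.
Variables I J : convex_subset P.

Definition low_set : set R := [set x | cset I x /\ forall y, cset J y -> (x < y)%R].
Definition high_set : set R := [set x | cset I x /\ forall y, cset J y -> (y < x)%R].

Lemma low_sub : low_set `<=` P. Proof. by move=> x [/cset_sub]. Qed.
Lemma high_sub : high_set `<=` P. Proof. by move=> x [/cset_sub]. Qed.

Lemma low_convex x y z : low_set x -> low_set z -> P y -> (x <= y)%R -> (y <= z)%R ->
  low_set y.
Proof.
move=> [Ix _] [Iz zJ] Py xy yz; split; first exact: cset_convex Ix Iz Py xy yz.
by move=> w /zJ; exact: le_lt_trans.
Qed.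

Lemma high_convex x y z : high_set x -> high_set z -> P y -> (x <= y)%R -> (y <= z)%R ->
  high_set y.
Proof.
move=> [Ix xJ] [Iz _] Py xy yz; split; first exact: cset_convex Ix Iz Py xy yz.
by move=> w /xJ wx; exact: lt_le_trans xy.
Qed.

Definition low_part := ConvexSubset low_sub low_convex.
Definition high_part := ConvexSubset high_sub high_convex.

Variable z : R.
Hypotheses (Iz : cset I z) (Jz : cset J z).

Lemma setD_low_high : cset I `\` cset J = low_set `|` high_set.
Proof.
apply/seteqP; split=> x; last first.
  by move=> [[Ix xJ]|[Ix xJ]]; split=> // /xJ; rewrite ltxx.
move=> [Ix nJx]; have Px := cset_sub Ix.
have [xz|zx] := leP x z; [left|right]; split=> // y Jy; rewrite ltNge; apply/negP => yx.
- by apply: nJx; exact: cset_convex Jy Jz Px yx xz.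
- by apply: nJx; exact: cset_convex Jz Jy Px (ltW zx) yx.
Qed.

Lemma low_part_measure : cset low_part !=set0 ->
  [/\ mu (cset low_part) = lo (cset J) - lo (cset I), lo (cset I) <= lo (cset J) &
      lo (cset J) \is a fin_num].
Proof.
move=> L0; have [_ ->] := hmu L0; have [x [Ix xJ]] := L0.
have xlo : x%:E <= lo (cset J).
  by apply/ereal_infP => _ [y Jy <-]; rewrite lee_fin ltW// xJ.
(* Points of [J] lie above the low part. Conversely, a point [y] above the low part either is at
   least [z] or lies in [I]; in the latter case some point of [J] is at most [y], as otherwise [y]
   would belong to the low part. *)
have hiE : hi (cset low_part) = lo (cset J).
  apply/le_anti/andP; split.
    apply: le_ereal_inf => _ [y Jy <-]; exists y => //; split; first exact: cset_sub Jy.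
    by move=> w [_]; apply.
  apply/ereal_infP => _ [y [Py yL] <-].
  have xy : (x < y)%R by apply: yL; split.
  have [zy|yz] := leP z y; first by apply: le_trans (lo_le Jz) _; rewrite lee_fin.
  apply: ge_ereal_inf; have Iy := cset_convex Ix Iz Py (ltW xy) (ltW yz).
  have [[w Jw wy]|H] := pselect (exists2 w, cset J w & (w <= y)%R).
    by exists w%:E; [exists w|rewrite lee_fin].
  have : low_set y by split=> // w Jw; rewrite ltNge; apply/negP => wy; apply: H; exists w.
  by move=> /yL; rewrite ltxx.
have loE : lo (cset low_part) = lo (cset I).
  apply/le_anti/andP; split; last first.
    by apply: le_ereal_inf => _ [y [Iy _] <-]; exists y.
  apply/ereal_infP => _ [y Iy <-]; apply: ge_ereal_inf.
  have [yx|xy] := leP y x; last by exists x%:E; [exists x|rewrite lee_fin ltW].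
  exists y%:E => //; exists y => //; split=> // w /xJ; exact: le_lt_trans.
split; first by rewrite -/(hi _) -/(lo _) hiE loE.
  exact: le_trans (lo_le Ix) xlo.
by rewrite fin_numElt (lt_le_trans (ltNyr x) xlo) (le_lt_trans (lo_le Jz) (ltry z)).
Qed.

Lemma low_part0 : cset low_part = set0 -> lo (cset J) <= lo (cset I).
Proof.
move=> L0; apply/ereal_infP => _ [x Ix <-]; apply: ge_ereal_inf.
have [[w Jw wx]|H] := pselect (exists2 w, cset J w & (w <= x)%R).
  by exists w%:E; [exists w|rewrite lee_fin].
suff : cset low_part x by rewrite L0.
by split=> // w Jw; rewrite ltNge; apply/negP => wx; apply: H; exists w.
Qed.

Lemma high_part_measure : cset high_part !=set0 ->
  [/\ mu (cset high_part) = hi (cset I) - hi (cset J), hi (cset J) <= hi (cset I) &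
      hi (cset J) \is a fin_num].
Proof.
move=> H0; have [_ ->] := hmu H0; have [x [Ix xJ]] := H0.
have hix : hi (cset J) <= x%:E.
  by apply: ereal_inf_lbound; exists x => //; split=> //; exact: cset_sub Ix.
(* A point of [P] above [J] either is at least [x] or lies between [z] and [x], hence in [I] and in
   the high part. *)
have loE : lo (cset high_part) = hi (cset J).
  apply/le_anti/andP; split; last first.
    apply: le_ereal_inf => _ [y [Iy yJ] <-]; exists y => //; split=> //.
    exact: cset_sub Iy.
  apply/ereal_infP => _ [y [Py yJ] <-]; apply: ge_ereal_inf.
  have [xy|yx] := leP x y; first by exists x%:E; [exists x|rewrite lee_fin].
  exists y%:E => //; exists y => //; split=> //.
  exact: cset_convex Iz Ix Py (ltW (yJ _ Jz)) (ltW yx).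
have hiE : hi (cset high_part) = hi (cset I).
  apply/le_anti/andP; split; last first.
    apply: le_ereal_inf => _ [y [Py yH] <-]; exists y => //; split=> // w Iw.
    have [wx|xw] := leP w x; first by apply: le_lt_trans wx _; apply: yH; split.
    by apply: yH; split=> // v /xJ vx; exact: lt_trans xw.
  by apply: le_ereal_inf => _ [y [Py yI] <-]; exists y => //; split=> // w [/yI].
split; first by rewrite -/(hi _) -/(lo _) hiE loE.
  exact: le_trans hix (hi_ge Ix).
by rewrite fin_numElt (lt_le_trans (ltNyr z) (hi_ge Jz)) (le_lt_trans hix (ltry x)).
Qed.

Lemma high_part0 : cset high_part = set0 -> hi (cset I) <= hi (cset J).
Proof.
move=> H0; apply: le_ereal_inf => _ [y [Py yJ] <-]; exists y => //; split=> // w Iw.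
have [[v Jv wv]|H] := pselect (exists2 v, cset J v & (w <= v)%R).
  by apply: le_lt_trans wv _; exact: yJ.
suff : cset high_part w by rewrite H0.
by split=> // v Jv; rewrite ltNge; apply/negP => vw; apply: H; exists v.
Qed.

End Parts.

Let hI I : cset I !=set0 -> S (cset I). Proof. by move=> /hmu[]. Qed.

Let mD I J : measurable (cset I `\` cset J : set T).
Proof. by apply: measurableD; exact: measurable_convex. Qed.

Lemma mu_setY I J : mu (cset I `+` cset J) = mu (cset I `\` cset J) + mu (cset J `\` cset I).
Proof.
by rewrite /setY measureU//; apply/seteqP; split=> // x [[Ix _] [_ /(_ Ix)]].
Qed.

Lemma mu_setD_overlap I J z : cset I z -> cset J z ->
  mu (cset I `\` cset J) = mu (cset (low_part I J)) + mu (cset (high_part I J)).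
Proof.
move=> Iz Jz; rewrite (setD_low_high I Jz) measureU//.
- exact: (measurable_convex hI (low_part I J)).
- exact: (measurable_convex hI (high_part I J)).
by apply/seteqP; split=> // x [[_ /(_ _ Jz) xz] [_ /(_ _ Jz) /(lt_trans xz)]]; rewrite ltxx.
Qed.

(** At most one of the two low parts is nonempty, that of the interval which starts first, and it
    measures the gap between the starts. *)
Lemma mu_low_parts I J z : cset I z -> cset J z ->
  mu (cset (low_part I J)) + mu (cset (low_part J I)) = absdiff (lo (cset I)) (lo (cset J)).
Proof.
move=> Iz Jz.
have [IJ0|/set0P IJ0] := eqVneq (cset (low_part I J)) set0;
    have [JI0|/set0P JI0] := eqVneq (cset (low_part J I)) set0.
- rewrite IJ0 JI0 measure0 adde0 /absdiff ifT//.
  by apply/eqP/le_anti; rewrite (low_part0 IJ0) (low_part0 JI0).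
- have [-> le_JI fI] := low_part_measure Jz Iz JI0.
  by rewrite IJ0 measure0 add0e absdiffC absdiff_le//; right.
- have [-> le_IJ fJ] := low_part_measure Iz Jz IJ0.
  by rewrite JI0 measure0 adde0 absdiff_le//; right.
- have [x [Ix xJ]] := IJ0; have [y [Jy yI]] := JI0.
  by have := lt_trans (xJ _ Jy) (yI _ Ix); rewrite ltxx.
Qed.

Lemma mu_high_parts I J z : cset I z -> cset J z ->
  mu (cset (high_part I J)) + mu (cset (high_part J I)) = absdiff (hi (cset I)) (hi (cset J)).
Proof.
move=> Iz Jz.
have [IJ0|/set0P IJ0] := eqVneq (cset (high_part I J)) set0;
    have [JI0|/set0P JI0] := eqVneq (cset (high_part J I)) set0.
- rewrite IJ0 JI0 measure0 adde0 /absdiff ifT//.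
  by apply/eqP/le_anti; rewrite (high_part0 IJ0) (high_part0 JI0).
- have [-> le_JI fI] := high_part_measure Jz Iz JI0.
  by rewrite IJ0 measure0 add0e absdiff_le//; left.
- have [-> le_IJ fJ] := high_part_measure Iz Jz IJ0.
  by rewrite JI0 measure0 adde0 absdiffC absdiff_le//; left.
- have [x [Ix xJ]] := IJ0; have [y [Jy yI]] := JI0.
  by have := lt_trans (xJ _ Jy) (yI _ Ix); rewrite ltxx.
Qed.

Lemma mu_setY_overlap I J : cset I `&` cset J !=set0 ->
  mu (cset I `+` cset J) = dist1 (dgm_point P (cset I)) (dgm_point P (cset J)).
Proof.
move=> [z [Iz Jz]]; rewrite mu_setY (mu_setD_overlap Iz Jz) (mu_setD_overlap Jz Iz).
by rewrite addeACA (mu_low_parts Iz Jz) (mu_high_parts Iz Jz).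
Qed.

Lemma mu_setY_disjoint I J : ~ (cset I `&` cset J !=set0) ->
  mu (cset I `+` cset J) = mu (cset I) + mu (cset J).
Proof.
move=> IJ0; rewrite mu_setY !setDidl//; apply/seteqP; split=> // x [Ix Jx];
  by apply: IJ0; exists x.
Qed.

(** Since [hi I <= lo J], replacing [lo J] by [hi I] in the first coordinate difference and [hi I]
    by [lo J] in the second only decreases them, to [mu I] and [mu J]. *)
Let dist1_disjoint I J : cset I !=set0 -> cset J !=set0 ->
  (forall x y, cset I x -> cset J y -> (x < y)%R) ->
  mu (cset I) + mu (cset J) <= dist1 (dgm_point P (cset I)) (dgm_point P (cset J)).
Proof.
move=> I0 J0 IJ; have [_ ->] := hmu I0; have [_ ->] := hmu J0.
rewrite /dist1 /= -!/(lo _) -!/(hi _).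
have [[x Ix] [y Jy]] := (I0, J0).
have hilo : hi (cset I) <= lo (cset J).
  apply: le_ereal_inf => _ [w Jw <-]; exists w => //; split; first exact: cset_sub Jw.
  by move=> v Iv; exact: IJ.
have hiI := hi_ge Ix; have loJ := lo_le Jy.
have hif : hi (cset I) \is a fin_num.
  by rewrite fin_numElt (lt_le_trans (ltNyr x) hiI) (le_lt_trans (le_trans hilo loJ) (ltry y)).
have lof : lo (cset J) \is a fin_num.
  by rewrite fin_numElt (lt_le_trans (ltNyr x) (le_trans hiI hilo)) (le_lt_trans loJ (ltry y)).
rewrite (@absdiff_le (lo _)); last by right.
  2: exact: le_trans (lo_le Ix) (le_trans hiI hilo).
rewrite absdiff_le; last by left.
  2: exact: le_trans hilo (le_trans loJ (hi_ge Jy)).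
by rewrite leeD// ?leeB// leeD2l// leeN2.
Qed.

Lemma mu_setY_le_dist1 I J : cset I !=set0 -> cset J !=set0 ->
  mu (cset I `+` cset J) <= dist1 (dgm_point P (cset I)) (dgm_point P (cset J)).
Proof.
move=> I0 J0; have [IJ|IJ] := pselect (cset I `&` cset J !=set0).
  by rewrite mu_setY_overlap.
rewrite mu_setY_disjoint//; have [[x Ix] [y Jy]] := (I0, J0).
(* Disjoint intervals are ordered as any one pair of their points is. *)
have sep (L M : convex_subset P) u v : ~ (cset L `&` cset M !=set0) ->
    cset L u -> cset M v -> (u < v)%R -> forall l m, cset L l -> cset M m -> (l < m)%R.
  move=> LM Lu Mv uv l m Ll Mm; rewrite ltNge; apply/negP => ml; apply: LM.
  have [lv|vl] := leP l v.
    by exists l; split=> //; exact: cset_convex Mm Mv (cset_sub Ll) ml lv.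
  by exists v; split=> //; exact: cset_convex Lu Ll (cset_sub Mv) (ltW uv) (ltW vl).
have [xy|yx|xy] := ltgtP x y; last by case: IJ; exists x; split; rewrite // xy.
  by apply: dist1_disjoint => //; exact: sep xy.
rewrite addeC /dist1 absdiffC (absdiffC (_.2)).
by apply: dist1_disjoint => //; apply: sep yx => //; rewrite setIC.
Qed.

End Diagrams.

(** * p-norms *)

Section Pnorm.
Variable R : realType.
Local Open Scope ereal_scope.

Lemma ge0_le_poweR (r : R) (x y : \bar R) : (0 <= r)%R -> 0 <= x -> x <= y ->
  x `^ r <= y `^ r.
Proof.
move=> r0 x0 xy; apply: gt0_ler_poweR => //; rewrite in_itv /= ?leey ?andbT//.
exact: le_trans xy.
Qed.

(** With [s = x + y], each [z] among [x], [y] has [z ^ r] equal to [z] times [z ^ (r - 1)], hence at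
    most [z] times [s ^ (r - 1)]; the two bounds add up to [s ^ r]. *)
Lemma poweR_superadditive (r : R) (x y : \bar R) : (1 <= r)%R -> 0 <= x -> 0 <= y ->
  x `^ r + y `^ r <= (x + y) `^ r.
Proof.
move=> r1; have r0 : (0 < r)%R by exact: lt_le_trans r1.
have rN0 : (r != 0)%R by rewrite gt_eqF.
case: x y => [x| |] [y| |] //=; rewrite ?(negPf rN0) ?leey// ?lee_fin => x0 y0.
have bound z s : (0 <= z)%R -> (z <= s)%R -> (z `^ r <= z * s `^ (r - 1))%R.
  rewrite le_eqVlt => /orP[/eqP <- _|z0 zs]; first by rewrite powR0// mul0r.
  rewrite -[X in (_ `^ X <= _)%R](subrKC 1%R) (@powRD _ z); last first.
    by apply/implyP => _; rewrite gt_eqF.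
  rewrite powRr1; last exact: ltW.
  apply: ler_wpM2l; first exact: ltW.
  by apply: ge0_ler_powR; rewrite ?subr_ge0// nnegrE ltW// (lt_le_trans z0).
have := lerD (bound x (x + y)%R x0 _) (bound y (x + y)%R y0 _).
rewrite lerDl lerDr => /(_ y0 x0) /le_trans; apply.
rewrite -mulrDl; have [->|s0] := eqVneq (x + y)%R 0%R; first by rewrite mul0r powR_ge0.
rewrite -[X in (X * _ <= _)%R]powRr1 ?addr_ge0// -powRD ?s0 ?implybT//.
by rewrite subrKC.
Qed.

Lemma pnorm_le (p : \bar R) (A : choiceType) (x y : A -> \bar R) : 1 <= p ->
  (forall a, 0 <= x a) -> (forall a, x a <= y a) -> pnorm p x <= pnorm p y.
Proof.
case: p => [r| |//] /=; rewrite ?lee_fin => p1 x0 xy; last first.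
  apply: ge_ereal_sup => _ [->|[a _ <-]]; first by apply: ereal_sup_ubound; left.
  by apply: le_trans (xy a) _; apply: ereal_sup_ubound; right; exists a.
have r0 : (0 <= r)%R by exact: le_trans p1.
apply: ge0_le_poweR; first by rewrite invr_ge0.
  by apply: esum_ge0 => a _; exact: poweR_ge0.
by apply: le_esum => a _; exact: ge0_le_poweR.
Qed.

Lemma esum_inj_le (A B : choiceType) (h : A -> B) (x : A -> \bar R) (y : B -> \bar R) :
  injective h -> (forall b, 0 <= y b) -> (forall a, x a <= y (h a)) ->
  \esum_(a in [set: A]) x a <= \esum_(b in [set: B]) y b.
Proof.
move=> hinj y0 xy; apply: (@le_trans _ _ (\esum_(a in [set: A]) y (h a))).
  by apply: le_esum => a _.
rewrite -(esum_image _ h) => [|a b _ _ /hinj//].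
rewrite esum_mkcond; apply: le_esum => b _.
by case: ifP.
Qed.

Lemma esum_sum_type (A B : choiceType) (x : (A + B)%type -> \bar R) :
  (forall i, 0 <= x i) ->
  \esum_(i in [set: A + B]) x i =
  \esum_(a in [set: A]) x (inl a) + \esum_(b in [set: B]) x (inr b).
Proof.
move=> x0; rewrite (esumID (range (@inl A B)))// !setTI; congr (_ + _).
  by rewrite (esum_image _ (@inl A B))// => a b _ _ [].
rewrite (_ : ~` _ = range (@inr A B)).
  by rewrite (esum_image _ (@inr A B))// => a b _ _ [].
apply/seteqP; split=> [[a|b] H|_ [b _ <-] [a]//]; last by exists b.
by case: H; exists a.
Qed.

(** Lets two entries of [x] be charged to the same entry of [y], one to its share [u] and the other
    to its share [v]. For finite [p] this rests on superadditivity of the power. *)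
Lemma pnorm_split (p : \bar R) (A B E : choiceType) (x : (A + B)%type -> \bar R)
    (y u v : E -> \bar R) (h : A -> E) (k : B -> E) :
  1 <= p -> injective h -> injective k ->
  (forall i, 0 <= x i) -> (forall e, 0 <= u e) -> (forall e, 0 <= v e) ->
  (forall a, x (inl a) <= u (h a)) -> (forall b, x (inr b) <= v (k b)) ->
  (forall e, u e + v e <= y e) -> pnorm p x <= pnorm p y.
Proof.
move=> + hinj kinj x0 u0 v0 xu xv uvy; case: p => [r| |//] /=; rewrite ?lee_fin => r1.
  have r0 : (0 <= r)%R by exact: le_trans r1.
  apply: ge0_le_poweR; first by rewrite invr_ge0.
    by apply: esum_ge0 => i _; exact: poweR_ge0.
  rewrite esum_sum_type; last by move=> i; exact: poweR_ge0.
  apply: (@le_trans _ _ (\esum_(e in [set: E]) (u e `^ r) + \esum_(e in [set: E]) (v e `^ r))).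
    apply: leeD; [apply: (esum_inj_le hinj)|apply: (esum_inj_le kinj)];
      by move=> i; rewrite ?poweR_ge0// ge0_le_poweR.
  rewrite -esumD => [|e _|e _]; try exact: poweR_ge0.
  apply: le_esum => e _; apply: le_trans (poweR_superadditive _ _ _) _ => //.
  by apply: ge0_le_poweR => //; exact: adde_ge0.
apply: ge_ereal_sup => _ [->|[[a|b] _ <-]]; first by apply: ereal_sup_ubound; left.
- apply: (@le_trans _ _ (y (h a))); last by apply: ereal_sup_ubound; right; exists (h a).
  by apply: le_trans (xu a) (le_trans _ (uvy _)); rewrite leeDl.
- apply: (@le_trans _ _ (y (k b))); last by apply: ereal_sup_ubound; right; exists (k b).
  by apply: le_trans (xv b) (le_trans _ (uvy _)); rewrite leeDr.
Qed.

End Pnorm.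

(** * Comparison of the distances *)

Section IntervalSums.
Variables (R : realType) (P : set R) (K : fieldType).

Lemma isomorphic_refl (M : pmod P K) : isomorphic M M.
Proof. by exists (hom_id M), (hom_id M). Qed.

Lemma isomorphic_zero (M N : pmod P K) : is_zero M -> is_zero N -> isomorphic M N.
Proof.
move=> M0 N0; exists (hom_zero M N), (hom_zero N M).
by split=> t v; [rewrite (M0 t v)|rewrite (N0 t v)].
Qed.

Definition empty_convex : convex_subset P :=
  @ConvexSubset R P set0 (@sub0set _ P) (fun x y z F _ _ _ _ => match F with end).

Lemma isomorphic_interval_reindex (A E : choiceType) (h : A -> E)
    (I : A -> convex_subset P) (J : E -> convex_subset P) :
  injective h -> (forall a, J (h a) = I a) ->
  (forall e, ~ range h e -> cset (J e) = set0) ->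
  isomorphic (pmod_sum (fun a => interval_mod K (I a)))
             (pmod_sum (fun e => interval_mod K (J e))).
Proof.
move=> hinj Jh J0.
apply: (@isomorphic_trans _ _ _ _ (pmod_sum ((fun e => interval_mod K (J e)) \o h))).
  by apply: isomorphic_sum => a /=; rewrite Jh; exact: isomorphic_refl.
by apply: isomorphic_reindex => // e /J0 Je0; apply/interval_mod_zero.
Qed.

Lemma summand_interval (A B : choiceType) (M_ : A -> pmod P K)
    (I : B -> convex_subset P) (M : pmod P K) :
  (forall a, is_zero (M_ a) \/ local_end (M_ a)) -> isomorphic M (pmod_sum M_) ->
  isomorphic M (pmod_sum (fun b => interval_mod K (I b))) ->
  exists I' : A -> convex_subset P, forall a, isomorphic (M_ a) (interval_mod K (I' a)).
Proof.
move=> locM MM MI.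
suff /choice[I' MI'] : forall a, exists L, isomorphic (M_ a) (interval_mod K L) by exists I'.
move=> a.
case: (locM a) => [M0|/local_summand_interval loc].
  by exists empty_convex; apply: isomorphic_zero => //; apply/interval_mod_zero.
have [b ?] := loc _ _ (isomorphic_trans (isomorphic_sym MM) MI).
by exists (I b).
Qed.

End IntervalSums.

(** * Inequalities between the three distances *)

Section Comparison.
Variables (R : realType) (P : set R) (S : set_system R).
Hypothesis hS : sigma_algebra P S.
Variable mu : {measure set (g_sigma_algebraType S) -> \bar R}.
Local Open Scope ereal_scope.
Hypothesis hmu : forall I : convex_subset P, cset I !=set0 ->
  S (cset I) /\
  mu (cset I) = ereal_inf (EFin @` above P (cset I)) - ereal_inf (EFin @` cset I).
Variables (K : fieldType) (M N : pmod P K) (p : \bar R).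
Hypothesis p1 : 1 <= p.

Let hI (I : convex_subset P) : cset I !=set0 -> S (cset I). Proof. by move=> /hmu[]. Qed.

Lemma path_dist_ge0 (M1 N1 : pmod P K) : 0 <= path_dist mu M1 N1.
Proof.
apply/ereal_infP => c /(zigzag_defect hS)[g [_ g0 <- _]].
by apply: integral_ge0.
Qed.

Lemma algebraic_Wp_le_interval :
  algebraic_Wp (path_dist mu (K := K)) p M N <= interval_Wp mu p M N.
Proof.
apply/ereal_infP => _ [A [I [J [MI [NJ ->]]]]]; apply: ge_ereal_inf.
have loc (L : convex_subset P) : is_zero (interval_mod K L) \/ local_end (interval_mod K L).
  have [L0|/set0P L0] := eqVneq (cset L) set0; first by left; apply/interval_mod_zero.
  by right; exact: interval_local_end.
exists (pnorm p (fun a => path_dist mu (interval_mod K (I a)) (interval_mod K (J a)))).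
  by exists A, (fun a => interval_mod K (I a)), (fun a => interval_mod K (J a)).
apply: pnorm_le => // a; first exact: path_dist_ge0.
exact: path_dist_interval_le.
Qed.

Variables (A B : choiceType) (IA : A -> convex_subset P) (IB : B -> convex_subset P).
Hypotheses (IA0 : forall a, cset (IA a) !=set0) (IB0 : forall b, cset (IB b) !=set0).
Hypothesis MA : isomorphic M (pmod_sum (fun a => interval_mod K (IA a))).
Hypothesis NB : isomorphic N (pmod_sum (fun b => interval_mod K (IB b))).

Lemma interval_Wp_le_algebraic :
  interval_Wp mu p M N <= algebraic_Wp (path_dist mu (K := K)) p M N.
Proof.
apply/ereal_infP => _ [E [M_ [N_ [locM [locN [MM [NN ->]]]]]]]; apply: ge_ereal_inf.
have [I MI] := summand_interval locM MM MA.
have [J NJ] := summand_interval locN NN NB.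
exists (pnorm p (fun e => mu (cset (I e) `+` cset (J e)))).
  exists E, I, J; split; first by apply: isomorphic_trans MM _; exact: isomorphic_sum.
  by split=> //; apply: isomorphic_trans NN _; exact: isomorphic_sum.
by apply: pnorm_le => // e; exact: path_dist_ge.
Qed.

Let x a := dgm_point P (cset (IA a)).
Let y b := dgm_point P (cset (IB b)).

(** The terms of a matching serve as index set: a matched pair becomes a pair of summands, and an
    unmatched interval is paired with the empty one. *)
Lemma interval_Wp_le_diagram : interval_Wp mu p M N <= diagram_Wp p x y.
Proof.
apply/ereal_infP => _ [C [phi [phi_inj ->]]]; apply: ge_ereal_inf.
pose E : choiceType := (C + (~` C) + (~` range phi))%type.
pose I (e : E) := match e with
  | inl (inl c) => IA (val c) | inl (inr a) => IA (val a) | inr _ => empty_convex P end.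
pose J (e : E) := match e with
  | inl (inl c) => IB (phi c) | inl (inr _) => empty_convex P | inr b => IB (val b) end.
exists (pnorm p (fun e => mu (cset (I e) `+` cset (J e)))); last first.
  apply: pnorm_le => // -[[c|a]|b].
  - exact: (mu_setY_le_dist1 hmu (IA0 (val c)) (IB0 (phi c))).
  - by change (mu (cset (IA (val a)) `+` set0) <= dist_diag (x (val a)));
      rewrite setY0 (dist_diag_dgm_point hmu).
  - by change (mu (set0 `+` cset (IB (val b))) <= dist_diag (y (val b)));
      rewrite set0Y (dist_diag_dgm_point hmu).
pose hA a : E := match pselect (C a) with
  | left Ca => inl (inl (exist _ a (mem_set Ca)))
  | right nCa => inl (inr (exist _ a (mem_set nCa))) end.
(* A matched [b] is located through a chosen preimage under [phi], which is the only one by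
   injectivity. *)
pose hB b : E := match pselect (range phi b) with
  | left Cb => inl (inl (projT1 (cid2 Cb)))
  | right nCb => inr (exist _ b (mem_set nCb)) end.
have IhA a : I (hA a) = IA a by rewrite /hA; case: pselect.
have JhB b : J (hB b) = IB b.
  by rewrite /hB; case: pselect => //= Cb; case: cid2 => /= c _ ->.
exists E, I, J; split; [|split=> //].
  apply: isomorphic_trans MA _; apply: (@isomorphic_interval_reindex _ _ _ _ _ hA) => //.
    move=> a a'; rewrite /hA.
    by case: pselect => Ca; case: pselect => Ca' // [].
  move=> [[[c Cc]|[a Ca]]|//] nh; exfalso; apply: nh.
    exists c => //; rewrite /hA; case: pselect => [Cc'|]; last by case; exact: set_mem.
    by congr (inl (inl _)); exact: val_inj.
  exists a => //; rewrite /hA; case: pselect => [Ca'|nCa]; first by have := set_mem Ca.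
  by congr (inl (inr _)); exact: val_inj.
apply: isomorphic_trans NB _; apply: (@isomorphic_interval_reindex _ _ _ _ _ hB) => //.
  move=> b b'; rewrite /hB; case: pselect => Cb; case: pselect => Cb' //.
    by case: cid2 => /= c _ <-; case: cid2 => /= c' _ <- [->].
  by case.
move=> [[c|//]|[b Cb]] nh; exfalso; apply: nh.
  exists (phi c) => //; rewrite /hB; case: pselect => [Cb|]; last by case; exists c.
  by case: cid2 => /= c' _ /phi_inj ->.
exists b => //; rewrite /hB; case: pselect => [Cb'|nCb]; first by have := set_mem Cb.
by congr inr; exact: val_inj.
Qed.

(** By uniqueness, [s] and [s'] identify the two diagrams with the nonempty summands [I e] and
    [J e]. Exactly the pairs that meet are matched; all other points go to the diagonal. *)
Lemma diagram_Wp_le_interval : diagram_Wp p x y <= interval_Wp mu p M N.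
Proof.
apply/ereal_infP => _ [E [I [J [MI [NJ ->]]]]]; apply: ge_ereal_inf.
have [s [s_inj sI s_onto]] :=
  interval_decomposition_unique IA0 (isomorphic_trans (isomorphic_sym MA) MI).
have [s' [s'_inj s'J s'_onto]] :=
  interval_decomposition_unique IB0 (isomorphic_trans (isomorphic_sym NB) NJ).
pose ov e := cset (I e) `&` cset (J e) !=set0.
pose C : set A := [set a | ov (s a)].
have exphi (c : C) : exists b, s' b = s (val c).
  have [z [_ Jz]] : ov (s (val c)) by exact: set_mem (valP c).
  by have [|b _ sb] := s'_onto (s (val c)); [exists z|exists b].
pose phi c := projT1 (cid (exphi c)).
have phiE c : s' (phi c) = s (val c) by exact: projT2 (cid (exphi c)).
have phi_inj : injective phi.
  by move=> c c' /(congr1 s'); rewrite !phiE => /s_inj /val_inj.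
set F := (X in pnorm p X).
(* The cost at [e] is split into [u] and [v]: a pair that meets is charged to [u] entirely, while a
   disjoint pair charges [I e] to [u] and [J e] to [v]. *)
pose u e := if `[< ov e >] then mu (cset (I e) `+` cset (J e)) else mu (cset (I e)).
pose v e := if `[< ov e >] then 0 else mu (cset (J e)).
pose h (i : C + ~` C) := match i with inl c => s (val c) | inr a => s (val a) end.
eexists; first by exists C, phi; split; [exact: phi_inj|reflexivity].
apply: (@pnorm_split _ p _ _ E _ _ u v h (fun b => s' (val b))) => //.
- move=> [c|a] [c'|a'] /= /s_inj.
  + by move=> cc; congr inl; exact: val_inj.
  + move=> cc; have nCa : ~ C (sval a') by exact: set_mem (valP a').
    by case: nCa; rewrite -cc; exact: set_mem (valP c).
  + move=> cc; have nCa : ~ C (sval a) by exact: set_mem (valP a).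
    by case: nCa; rewrite cc; exact: set_mem (valP c').
  + by move=> cc; congr inr; exact: val_inj.
- by move=> b b' /s'_inj bb'; exact: val_inj.
- move=> [[c|a]|b]; first exact: dist1_ge0.
  + by rewrite (dist_diag_dgm_point hmu).
  + by rewrite (dist_diag_dgm_point hmu).
- by move=> e; rewrite /u; case: ifP.
- by move=> e; rewrite /v; case: ifP.
- move=> [c|a] /=; rewrite /u.
    have ovc : ov (s (val c)) by exact: set_mem (valP c).
    rewrite asboolT// (mu_setY_overlap hmu)// sI /x /y.
    by rewrite -(s'J (phi c)) phiE.
  rewrite asboolF; last exact: set_mem (valP a).
  by rewrite sI (dist_diag_dgm_point hmu).
- move=> b /=; rewrite /v asboolF; first by rewrite s'J (dist_diag_dgm_point hmu).
  (* If the intervals met at the index of an unmatched [b], then [I] would be nonempty there, so the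
     index would come from some [a] in [C], matched to [b]. *)
  move=> ovb; have [z [Iz _]] := ovb; have [|a _ sa] := s_onto (s' (val b)); first by exists z.
  have := set_mem (valP b); apply.
  have Ca : C a by rewrite /C /= sa.
  by exists (exist _ a (mem_set Ca)) => //; apply: s'_inj; rewrite phiE.
- move=> e; rewrite /u /v; case: asboolP => ove; first by rewrite adde0.
  by rewrite -(mu_setY_disjoint hmu ove).
Qed.

End Comparison.

Local Open Scope ereal_scope.

Theorem theorem1p4 (R : realType) (P : set R)
    (S : set_system R) (hSP : forall E, S E -> E `<=` P) (hS : sigma_algebra P S)
    (mu : {measure set (g_sigma_algebraType S) -> \bar R})
    (hmu : forall I : convex_subset P, cset I !=set0 ->
      S (cset I) /\
      mu (cset I) = ereal_inf (EFin @` above P (cset I)) - ereal_inf (EFin @` cset I))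
    (K : fieldType) (M N : pmod P K)
    (A B : choiceType) (x : A -> \bar R * \bar R) (y : B -> \bar R * \bar R)
    (hM : is_dgm M x) (hN : is_dgm N y)
    (p : \bar R) (hp : 1 <= p) :
  algebraic_Wp (path_dist mu (K := K)) p M N = interval_Wp mu p M N /\
  interval_Wp mu p M N = diagram_Wp p x y.
Proof.
case: hM => IA [IA0 [MA /funext ->]]; case: hN => IB [IB0 [NB /funext ->]].
split; apply/le_anti/andP; split.
- exact: algebraic_Wp_le_interval.
- exact: interval_Wp_le_algebraic MA NB.
- exact: interval_Wp_le_diagram MA NB.
- exact: diagram_Wp_le_interval MA NB.
Qed.
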